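(* Let $K$ be a field of characteristic zero, let $G$ be a finite abelian group, and let $A$ be a commutative semisimple left Yetter-Drinfel'd Hopf algebra over the group ring $K[G]$. If $\dim(A)$ and $|G|$ are relatively prime, then $A$ is trivial, i.e. the quasisymmetry satisfies $\sigma_{A,A}(a\otimes a')=a'\otimes a$ for all $a,a'\in A$.
   Context: Let $H=K[G]$ with $G$ finite abelian (coproduct $g\mapsto g\otimes g$, counit $\varepsilon_H(g)=1$ for $g\in G$). A left Yetter-Drinfel'd module over $H$ is a left $H$-module $V$ that is also a left $H$-comodule, with coaction written $\delta(v)=v^{(1)}\otimes v^{(2)}\in H\otimes V$, such that $\delta(h.v)=v^{(1)}\otimes h.v^{(2)}$ for all $h\in H$, $v\in V$. The base field $K$ carries the trivial structures $h.\xi=\varepsilon_H(h)\xi$, $\delta(\xi)=1_H\otimes\xi$, and tensor products of Yetter-Drinfel'd modules carry the diagonal action and codiagonal coaction. The quasisymmetry is $\sigma_{V,W}:V\otimes W\to W\otimes V$, $v\otimes w\mapsto v^{(1)}.w\otimes v^{(2)}$. A left Yetter-Drinfel'd Hopf algebra over $H$ is a left Yetter-Drinfel'd module $A$ that is an associative unital algebra whose multiplication and unit map are $H$-linear and colinear, and a coalgebra whose coproduct $\Delta_A(a)=a_{(1)}\otimes a_{(2)}$ and counit $\varepsilon_A$ are $H$-linear and colinear, such that $\varepsilon_A:A\to K$ and $\Delta_A:A\to A\hat\otimes A$ are algebra homomorphisms, where $A\hat\otimes A$ is the vector space $A\otimes A$ with multiplication $(a\otimes a')(b\otimes b')=a(a'^{(1)}.b)\otimes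 a'^{(2)}b'$, and such that there is an $H$-linear and colinear map $S_A:A\to A$ (the antipode) with $S_A(a_{(1)})a_{(2)}=a_{(1)}S_A(a_{(2)})=\varepsilon_A(a)1_A$ for all $a\in A$. A semisimple such $A$ is automatically finite-dimensional. *)

(* Defs.v *)
From HB Require Import structures.
From mathcomp Require Import all_boot all_order all_algebra all_fingroup all_field.

Set Implicit Arguments.
Unset Strict Implicit.
Unset Printing Implicit Defensive.

Import GRing.Theory.
Local Open Scope ring_scope.

(* Tensor product of finite-dimensional vector spaces.  The model is          *)
(* coordinates in the product of the bases vbasis fullv; tliftE and    *)
(* tens_ext are the universal property.                                       *)

Section TensorType.
Variables (K : fieldType) (U V : vectType K).

Definition tens := 'M[K]_(\dim {:U}, \dim {:V}).
HB.instance Definition _ := Vector.on tens.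

Definition pure_tens (u : U) (v : V) : tens :=
  \matrix_(i, j) (coord (vbasis {:U}) i u * coord (vbasis {:V}) j v).

End TensorType.

Notation "u \ot v" := (pure_tens u v) (at level 45, right associativity).

Section TensorLift.
Variables (K : fieldType) (U V W : vectType K).

Definition tlift_fun (f : U -> V -> W) (t : tens U V) : W :=
  \sum_i \sum_j t i j *: f (vbasis {:U})`_i (vbasis {:V})`_j.

Fact tlift_fun_linear f : linear (tlift_fun f).
Proof.
move=> k s t; rewrite /tlift_fun scaler_sumr -big_split /=.
apply: eq_bigr => i _; rewrite scaler_sumr -big_split /=.
by apply: eq_bigr => j _; rewrite !mxE scalerDl scalerA.
Qed.
HB.instance Definition _ f :=
  GRing.isLinear.Build K (tens U V) W _ (tlift_fun f) (tlift_fun_linear f).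

(* Sends u \ot v to f u v, provided that f is bilinear.  In Sweedler          *)
(* notation, tlift f t is f t_1 t_2.                                          *)
Definition tlift f : 'Hom(tens U V, W) := linfun (tlift_fun f).

Definition bilin (f : U -> V -> W) := bilinear_for *:%R *:%R f.

Lemma tliftE f u v : bilin f -> tlift f (u \ot v) = f u v.
Proof.
move=> [fl fr]; rewrite lfunE /= /tlift_fun.
pose fL v := HB.pack (f ^~ v) (GRing.isLinear.Build _ _ _ _ (f ^~ v) (fl v))
  : {linear U -> W}.
pose fR u := HB.pack (f u) (GRing.isLinear.Build _ _ _ _ (f u) (fr u))
  : {linear V -> W}.
transitivity (fL v (\sum_i coord (vbasis {:U}) i u *: (vbasis {:U})`_i));
  last by rewrite -coord_vbasis ?memvf.
rewrite linear_sum; apply: eq_bigr => i _; rewrite linearZ.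
transitivity (coord (vbasis {:U}) i u *: fR (vbasis {:U})`_i
    (\sum_j coord (vbasis {:V}) j v *: (vbasis {:V})`_j));
  last by rewrite -coord_vbasis ?memvf.
rewrite linear_sum scaler_sumr; apply: eq_bigr => j _.
by rewrite linearZ scalerA mxE.
Qed.

End TensorLift.

Section TensorTheory.
Variables (K : fieldType) (U V W : vectType K).

Lemma pure_tens_bilin : bilin (@pure_tens K U V).
Proof.
split=> [v|u] k x y; apply/matrixP=> i j; rewrite !mxE linearP /=.
  by rewrite mulrDl mulrA.
by rewrite mulrDr mulrCA.
Qed.

Lemma tens_ext (f g : 'Hom(tens U V, W)) :
  (forall u v, f (u \ot v) = g (u \ot v)) -> f = g.
Proof.
move=> fg; apply/lfunP => t.
suff ->: t = \sum_i \sum_j t i j *: ((vbasis {:U})`_i \ot (vbasis {:V})`_j).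
  rewrite !linear_sum; apply: eq_bigr => i _; rewrite !linear_sum.
  by apply: eq_bigr => j _; rewrite !linearZ /= fg.
rewrite [LHS]matrix_sum_delta; apply: eq_bigr => i _; apply: eq_bigr => j _.
congr (_ *: _); apply/matrixP=> i' j'; rewrite !mxE.
rewrite !coord_free ?(basis_free (vbasisP _)) //.
by rewrite -natrM mulnb [i == _]eq_sym [j == _]eq_sym.
Qed.

End TensorTheory.

Definition tmap (K : fieldType) (U U' V V' : vectType K)
    (f : 'Hom(U, U')) (g : 'Hom(V, V')) : 'Hom(tens U V, tens U' V') :=
  tlift (fun u v => f u \ot g v).

Definition tassoc (K : fieldType) (U V W : vectType K) :
    'Hom(tens (tens U V) W, tens U (tens V W)) :=
  tlift (fun t w => tlift (fun u v => u \ot v \ot w) t).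

Section TensorMaps.
Variable K : fieldType.
Implicit Types U V W Z : vectType K.

Lemma tlift_linearP U V W (F F1 F2 : U -> V -> W) k t :
  (forall u v, F u v = k *: F1 u v + F2 u v) ->
  tlift F t = k *: tlift F1 t + tlift F2 t.
Proof.
move=> FE; rewrite !lfunE /= /tlift_fun scaler_sumr -big_split.
apply: eq_bigr => i _; rewrite scaler_sumr -big_split; apply: eq_bigr => j _ /=.
by rewrite FE scalerDr !scalerA mulrC.
Qed.

Lemma tmapE (U U' V V' : vectType K) (f : 'Hom(U, U')) (g : 'Hom(V, V')) u v :
  tmap f g (u \ot v) = f u \ot g v.
Proof.
have [pl pr] := @pure_tens_bilin K U' V'.
by apply: tliftE; split=> [w|w] k x y; rewrite linearP ?pl ?pr.
Qed.

Lemma tassocE U V W (u : U) (v : V) (w : W) :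
  tassoc U V W ((u \ot v) \ot w) = u \ot v \ot w.
Proof.
have [pl pr] := @pure_tens_bilin K V W.
have [ql qr] := @pure_tens_bilin K U (tens V W).
have bil x : bilin (fun u v => u \ot v \ot x : tens U (tens V W)).
  by split=> [y|y] k a b /=; rewrite ?ql // pl qr.
rewrite /tassoc tliftE ?tliftE //; split=> [x|t] k a b; first exact: linearP.
by apply: tlift_linearP => x y; rewrite pr qr.
Qed.

End TensorMaps.

Section GroupAlgebra.
Variables (K : fieldType) (gT : finGroupType).

(* h : grpalg is the sum of the h g *: g.  The tag hides the pointwise ring   *)
(* structure of {ffun gT -> K}.                                               *)
Definition grpalg := {ffun gT -> K^o}.
HB.instance Definition _ := Vector.on grpalg.

Definition gelt (g : gT) : grpalg := [ffun x => (x == g)%:R].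

Definition grpalg_mul (h k : grpalg) : grpalg :=
  [ffun x => \sum_y h y * k (y^-1 * x)%g].

Fact grpalg_mulA : associative grpalg_mul.
Proof.
move=> h k l; apply/ffunP=> x; rewrite !ffunE.
transitivity (\sum_y \sum_z h y * (k (y^-1 * z)%g * l (z^-1 * x)%g)).
  apply: eq_bigr => y _; rewrite ffunE mulr_sumr.
  rewrite (reindex_inj (mulgI y^-1%g)) /=; apply: eq_bigr => z _.
  by rewrite invMg invgK mulgA -(mulgA _ y) mulgV mulg1.
rewrite exchange_big; apply: eq_bigr => z _; rewrite ffunE mulr_suml.
by apply: eq_bigr => y _; rewrite mulrA.
Qed.

Fact grpalg_mul1 : left_id (gelt 1%g) grpalg_mul.
Proof.
move=> h; apply/ffunP=> x; rewrite ffunE (bigD1 1%g) //= ffunE eqxx mul1r.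
rewrite invg1 mul1g big1 ?addr0 // => y /negPf ny1.
by rewrite ffunE ny1 mul0r.
Qed.

Fact grpalg_mulr1 : right_id (gelt 1%g) grpalg_mul.
Proof.
move=> h; apply/ffunP=> x; rewrite ffunE (bigD1 x) //= ffunE mulVg eqxx mulr1.
rewrite big1 ?addr0 // => y nyx.
by rewrite ffunE -eq_mulVg1 (negPf nyx) mulr0.
Qed.

Fact grpalg_mulDl : left_distributive grpalg_mul +%R.
Proof.
move=> h k l; apply/ffunP=> x; rewrite !ffunE -big_split /=.
by apply: eq_bigr => y _; rewrite ffunE mulrDl.
Qed.

Fact grpalg_mulDr : right_distributive grpalg_mul +%R.
Proof.
move=> h k l; apply/ffunP=> x; rewrite !ffunE -big_split /=.
by apply: eq_bigr => y _; rewrite ffunE mulrDr.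
Qed.

Fact grpalg_1neq0 : gelt 1%g != 0.
Proof. by apply/eqP => /ffunP/(_ 1%g)/eqP; rewrite !ffunE eqxx oner_eq0. Qed.

HB.instance Definition _ := GRing.Zmodule_isNzRing.Build grpalg
  grpalg_mulA grpalg_mul1 grpalg_mulr1 grpalg_mulDl grpalg_mulDr grpalg_1neq0.

Fact grpalg_scaleAl (c : K) (h k : grpalg) : c *: (h * k) = (c *: h) * k.
Proof.
apply/ffunP=> x; rewrite !ffunE scaler_sumr.
by apply: eq_bigr => y _; rewrite ffunE /= -scalerAl.
Qed.

HB.instance Definition _ :=
  GRing.Lmodule_isLalgebra.Build K grpalg grpalg_scaleAl.

Fact grpalg_scaleAr (c : K) (h k : grpalg) : c *: (h * k) = h * (c *: k).
Proof.
apply/ffunP=> x; rewrite !ffunE scaler_sumr.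
by apply: eq_bigr => y _; rewrite ffunE /= -scalerAr.
Qed.

HB.instance Definition _ :=
  GRing.Lalgebra_isAlgebra.Build K grpalg grpalg_scaleAr.

Lemma geltM g k : gelt g * gelt k = gelt (g * k)%g.
Proof.
apply/ffunP=> x; rewrite ffunE (bigD1 g) //= !ffunE eqxx mul1r.
rewrite -(inj_eq (mulgI g)) mulgA mulgV mul1g big1 ?addr0 // => y /negPf nyg.
by rewrite ffunE nyg mul0r.
Qed.

Lemma grpalgE (h : grpalg) : h = \sum_g h g *: gelt g.
Proof.
apply/ffunP=> x; rewrite sum_ffunE (bigD1 x) //= !ffunE eqxx.
rewrite big1 => [|y nyx]; first by rewrite addr0 [_ *: _]mulr1.
by rewrite !ffunE eq_sym (negPf nyx) scaler0.
Qed.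

(* Linear extensions of g |-> g \ot g and of g |-> 1. *)
Definition grpalg_comul_fun (h : grpalg) : tens grpalg grpalg :=
  \sum_g h g *: (gelt g \ot gelt g).

Definition grpalg_counit_fun (h : grpalg) : K^o := \sum_g h g.

Fact grpalg_comul_linear : linear grpalg_comul_fun.
Proof.
move=> c h k; rewrite scaler_sumr -big_split /=; apply: eq_bigr => g _.
by rewrite !ffunE scalerDl scalerA.
Qed.
HB.instance Definition _ := GRing.isLinear.Build K grpalg (tens grpalg grpalg) _
  grpalg_comul_fun grpalg_comul_linear.

Fact grpalg_counit_linear : linear grpalg_counit_fun.
Proof.
move=> c h k; rewrite scaler_sumr -big_split /=; apply: eq_bigr => g _.
by rewrite !ffunE.
Qed.
HB.instance Definition _ := GRing.isLinear.Build K grpalg K^o _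
  grpalg_counit_fun grpalg_counit_linear.

Definition grpalg_comul : 'Hom(grpalg, tens grpalg grpalg) :=
  linfun grpalg_comul_fun.
Definition grpalg_counit : 'Hom(grpalg, K^o) := linfun grpalg_counit_fun.

Lemma grpalg_comul_gelt g : grpalg_comul (gelt g) = gelt g \ot gelt g.
Proof.
rewrite lfunE /= /grpalg_comul_fun (bigD1 g) //= ffunE eqxx scale1r.
by rewrite big1 ?addr0 // => x /negPf nxg; rewrite ffunE nxg scale0r.
Qed.

Lemma grpalg_counit_gelt g : grpalg_counit (gelt g) = 1.
Proof.
rewrite lfunE /= /grpalg_counit_fun (bigD1 g) //= ffunE eqxx.
by rewrite big1 ?addr0 // => x /negPf nxg; rewrite ffunE nxg.
Qed.

End GroupAlgebra.

(* Left Yetter-Drinfel'd modules over H = K[G], G abelian.  yd_data only      *)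
(* carries the action and the coaction; the axioms are is_ydmodule.           *)

Section YetterDrinfeld.
Variables (K : fieldType) (gT : finGroupType).
Local Notation H := (grpalg K gT).

Record yd_data (V : vectType K) := YDData {
  yd_act : 'Hom(H, 'End(V));
  yd_coact : 'Hom(V, tens H V)
}.

Record is_ydmodule (V : vectType K) (X : yd_data V) : Prop := IsYDModule {
  ydm_act1 : yd_act X 1 = \1%VF;
  ydm_actM : forall h k, yd_act X (h * k) = (yd_act X h \o yd_act X k)%VF;
  ydm_coassoc : forall v,
    tassoc H H V (tmap (grpalg_comul K gT) \1%VF (yd_coact X v)) =
    tmap \1%VF (yd_coact X) (yd_coact X v);
  ydm_counit : forall v,
    tlift (fun h v' => grpalg_counit K gT h *: v') (yd_coact X v) = v;
  (* the general compatibility reduces to this when G is abelian *)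
  ydm_compat : forall h v,
    yd_coact X (yd_act X h v) = tmap \1%VF (yd_act X h) (yd_coact X v)
}.

Definition yd_triv : yd_data K^o := YDData
  (linfun (fun h : H => grpalg_counit K gT h *: (\1%VF : 'End(K^o))))
  (linfun (fun c : K^o => (1 : H) \ot c)).

Definition yd_tens (V W : vectType K) (X : yd_data V) (Y : yd_data W) :
    yd_data (tens V W) := YDData
  (tlift (fun h k => tmap (yd_act X h) (yd_act Y k)) \o grpalg_comul K gT)%VF
  (tlift (fun v w =>
     tlift (fun (h : H) v' =>
       tlift (fun (k : H) w' => (h * k) \ot v' \ot w') (yd_coact Y w))
       (yd_coact X v))).

Record yd_hom (V W : vectType K) (X : yd_data V) (Y : yd_data W)
    (f : 'Hom(V, W)) : Prop := YDHom {
  yd_hom_act : forall h v, f (yd_act X h v) = yd_act Y h (f v);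
  yd_hom_coact : forall v, yd_coact Y (f v) = tmap \1%VF f (yd_coact X v)
}.

Definition quasisym (V W : vectType K) (X : yd_data V) (Y : yd_data W) :
    'Hom(tens V W, tens W V) :=
  tlift (fun v w => tlift (fun h v' => yd_act Y h w \ot v') (yd_coact X v)).

Lemma yd_act_tensE (V W : vectType K) (X : yd_data V) (Y : yd_data W) g v w :
  yd_act (yd_tens X Y) (gelt K g) (v \ot w) =
  yd_act X (gelt K g) v \ot yd_act Y (gelt K g) w.
Proof.
rewrite comp_lfunE grpalg_comul_gelt tliftE ?tmapE //.
have [pl pr] := @pure_tens_bilin K V W.
split=> [h|h] k x y; apply: tens_ext => v' w';
  rewrite add_lfunE scale_lfunE !tmapE linearP add_lfunE scale_lfunE ?pl //.
by rewrite pr.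
Qed.

Lemma yd_coact_tensE (V W : vectType K) (X : yd_data V) (Y : yd_data W) v w :
  yd_coact (yd_tens X Y) (v \ot w) =
  tlift (fun (h : H) v' =>
    tlift (fun (k : H) w' => (h * k) \ot v' \ot w') (yd_coact Y w))
    (yd_coact X v).
Proof.
have [pl pr] := @pure_tens_bilin K V W.
have [ql qr] := @pure_tens_bilin K H (tens V W).
rewrite tliftE //; split=> [w'|v'] k x y; first by rewrite !linearP.
by apply: tlift_linearP => h v''; rewrite !linearP.
Qed.

Lemma quasisymE (V W : vectType K) (X : yd_data V) (Y : yd_data W) v w :
  quasisym X Y (v \ot w) =
  tlift (fun h v' => yd_act Y h w \ot v') (yd_coact X v).
Proof.
have [pl pr] := @pure_tens_bilin K W V.
rewrite /quasisym tliftE //; split=> [w'|v'] k x y; first by rewrite !linearP.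
by apply: tlift_linearP => h v''; rewrite linearP pl.
Qed.

Section HopfAlgebra.
Variables (A : falgType K) (X : yd_data A).

Definition alg_mul : 'Hom(tens A A, A) := tlift (fun a b => a * b).
Definition alg_unit : 'Hom(K^o, A) := linfun (fun c : K^o => (c : K)%:A).

(* (a \ot a') (b \ot b') = a (a'^(1) . b) \ot a'^(2) b' *)
Definition braided_mul : 'Hom(tens A A, 'End(tens A A)) :=
  tlift (fun a a' => tlift (fun b b' =>
    tlift (fun h x => (a * yd_act X h b) \ot (x * b')) (yd_coact X a'))).

Lemma alg_mulE a b : alg_mul (a \ot b) = a * b.
Proof.
apply: tliftE; split=> c k x y; first by rewrite mulrDl -scalerAl.
by rewrite mulrDr -scalerAr.
Qed.

Lemma braided_mulE a a' b b' :
  braided_mul (a \ot a') (b \ot b') =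
  tlift (fun h x => (a * yd_act X h b) \ot (x * b')) (yd_coact X a').
Proof.
have [pl pr] := @pure_tens_bilin K A A.
have inner c c' : bilin (fun b b' : A =>
    tlift (fun h x => (c * yd_act X h b) \ot (x * b')) (yd_coact X c')).
  split=> [d|d] k x y; apply: tlift_linearP => h z.
    by rewrite linearP mulrDr -scalerAr pl.
  by rewrite mulrDr -scalerAr pr.
rewrite /braided_mul tliftE ?tliftE //; split=> [c|c] k x y;
  apply: tens_ext => d d'; rewrite add_lfunE scale_lfunE !tliftE //.
  by apply: tlift_linearP => h z; rewrite mulrDl -scalerAl pl.
by rewrite !linearP.
Qed.

Record is_yd_hopf (Delta : 'Hom(A, tens A A)) (eps : 'Hom(A, K^o)) : Prop :=
  IsYDHopf {
  ydh_module : is_ydmodule X;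
  ydh_mul : yd_hom (yd_tens X X) X alg_mul;
  ydh_unit : yd_hom yd_triv X alg_unit;
  ydh_comul : yd_hom X (yd_tens X X) Delta;
  ydh_counit : yd_hom X yd_triv eps;
  ydh_coassoc : forall a,
    tassoc A A A (tmap Delta \1%VF (Delta a)) = tmap \1%VF Delta (Delta a);
  ydh_counitl : forall a, tlift (fun x y => eps x *: y) (Delta a) = a;
  ydh_counitr : forall a, tlift (fun x y => eps y *: x) (Delta a) = a;
  ydh_comulM : forall a b, Delta (a * b) = braided_mul (Delta a) (Delta b);
  ydh_comul1 : Delta 1 = 1 \ot 1;
  ydh_counitM : forall a b, eps (a * b) = (eps a : K) * eps b;
  ydh_counit1 : eps 1 = 1;
  ydh_antipode : exists S : 'End(A),
    [/\ yd_hom X X S,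
        forall a, tlift (fun x y => S x * y) (Delta a) = (eps a : K)%:A
      & forall a, tlift (fun x y => x * S y) (Delta a) = (eps a : K)%:A]
}.

End HopfAlgebra.

End YetterDrinfeld.

Section Semisimple.
Variables (K : fieldType) (A : falgType K).

Definition left_ideal (I : {vspace A}) := forall a x, x \in I -> a * x \in I.

Definition simple_left_ideal (I : {vspace A}) :=
  [/\ left_ideal I, I != 0%VS
    & forall J : {vspace A}, left_ideal J -> (J <= I)%VS -> J = 0%VS \/ J = I].

(* The left regular module is a direct sum of simple modules. *)
Definition semisimple_alg := exists (n : nat) (I : 'I_n -> {vspace A}),
  [/\ forall i, simple_left_ideal (I i), directv (\sum_i I i)
    & (\sum_i I i)%VS = {:A}%VS].

End Semisimple.

(* Main.v *)
(* Over a splitting field L, the algebra homomorphisms A -> L form a basis X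
   of grouplikes of the dual algebra B, on which G (by the action) and its
   dual group (by the grading) act by permutations.  Writing x_g for the
   component of degree g, Delta (x y) = sum_g x (g y) (x) x_g y, so sigma is
   trivial iff g y = y whenever x_g <> 0; call (x, y) compatible in that case.
   Take a minimal G-stable, graded Hopf subalgebra spanned by S <= X in which
   some pair is incompatible; all proper ones are then group algebras with
   trivial braiding, and their dimensions divide that of S.
   - Computing a trace on B in two ways gives x_g t_g = 0 for g <> 1, where
     t_g is the sum of the g-fixed points of S.  Since |S| is prime to |G|,
     every coset of the g-fixed points then contains a point fixed by a
     character that is nontrivial on g.  Hence, if g witnesses the
     incompatibility, S is generated by points x whose stabilizer does not
     fix all of S.
   - Two such points x, y are compatible: otherwise, for a p-element h with
     x_h <> 0 and h y <> y, some z in the support of x y is fixed by k = h chi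
     with chi y = y.  Then (k y) y^-1 is a fixed point of k in a group of order
     prime to p, on whose translates of y the p-element k acts by translation
     by (k y) y^-1; a fixed point of this action yields h y = y. *)

Require Import Defs.
From mathcomp Require Import all_boot all_order all_algebra all_fingroup all_field.
From HB Require Import structures.
From mathcomp Require Import all_solvable all_character.
From Stdlib Require Import Classical_Prop.

Set Implicit Arguments.
Unset Strict Implicit.
Unset Printing Implicit Defensive.

Import GRing.Theory.
Local Open Scope ring_scope.

(** * Splitting fields and characters *)

(** Strong induction on the size of [p]. Irreducibility over an arbitrary field is not decidable in
    general, whence the classical case distinction. *)
Lemma irreducible_factor (F : fieldType) (p : {poly F}) : (1 < size p)%N ->
  exists2 r, r %| p & irreducible_poly r.
Proof.
have [n] := ubnP (size p); elim: n p => // n IHn p; rewrite ltnS => sp p1.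
have [irr|nirr] := classic (irreducible_poly p); first by exists p.
have [q [q1 qp npq]] : exists q : {poly F}, [/\ size q != 1%N, q %| p & ~~ (q %= p)].
  apply: NNPP => h; apply: nirr; split=> // q q1 qp; apply: contra_notT h => npq.
  by exists q.
have p0 : p != 0 by rewrite -size_poly_gt0 ltnW.
have q_gt1 : (1 < size q)%N.
  by rewrite ltn_neqAle eq_sym q1 size_poly_gt0 (dvdpN0 qp).
have qlt : (size q < size p)%N.
  by rewrite ltn_neqAle dvdp_leq // andbT; apply: contra npq; rewrite -dvdp_size_eqp.
have [r rq irr] := IHn q (leq_trans qlt sp) q_gt1.
by exists r; rewrite // (dvdp_trans rq).
Qed.

Definition map_alg (F : fieldType) (L : fieldExtType F) := map_poly (in_alg L) :
  {poly F} -> {poly L}.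

(** A root of an irreducible factor is adjoined, and the induction continues over the larger field
    [K] with the remaining cofactor. *)
Lemma splitting_field_exists (F : fieldType) (p : {poly F}) : p != 0 ->
  exists (L : fieldExtType F) (zs : seq L), map_alg L p %= \prod_(z <- zs) ('X - z%:P).
Proof.
have mapXsubC (R S : nzRingType) (f : {rmorphism R -> S}) x :
    map_poly f ('X - x%:P) = 'X - (f x)%:P.
  by rewrite rmorphB /= map_polyX map_polyC.
move: {2}_.+1 (ltnSn (size p)) => n; elim: n => // n IHn in F p * => lbn nz_p.
have [Cp|C'p] := leqP (size p) 1.
  exists F^o, [::].
  by rewrite big_nil -size_poly_eq1 size_map_poly eqn_leq Cp size_poly_gt0.
have [r r_dv_p irr_r] := irreducible_factor C'p.
have{irr_r} [K _ [x rx0 _]] := irredp_FAdjoin irr_r.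
have{r rx0 r_dv_p} /factor_theorem[q Dp] : root (map_alg K p) x.
  by rewrite -(divpK r_dv_p) [map_alg K _]rmorphM rootM rx0 orbT.
have Dszp : size p = size (q * ('X - x%:P)) by rewrite -Dp size_map_poly.
have nz_q : q != 0.
  by move: nz_p; rewrite -size_poly_eq0 Dszp size_poly_eq0 mulf_eq0 => /norP[].
have [|L [zs Dq]] := IHn K q _ nz_q.
  by rewrite ltnS Dszp size_mul ?polyXsubC_eq0 ?size_XsubC ?addn2 in lbn.
(* [L] was built as an extension of [K]; [baseFieldType L] is the same field viewed over [F], and
   the two embeddings of coefficients agree. *)
suffices [zs' h] : exists zs' : seq L, map_alg L (map_alg K p) %= \prod_(z <- zs') ('X - z%:P).
  rewrite -[map_alg L _]map_poly_comp in h.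
  rewrite -(eq_map_poly (fun a : F => baseField_scaleE a 1)) in h.
  by exists (baseFieldType L), zs'.
exists (x%:A :: zs); rewrite big_cons; set rhs := _ * _.
by rewrite Dp mulrC [map_alg L _]rmorphM /= mapXsubC /= eqp_mull.
Qed.

(** In characteristic zero X^N - 1 is separable, so [zs] contains N distinct N-th roots of unity,
    and N such roots in a field include a primitive one. *)
Lemma prim_root_exists (L : fieldType) (N : nat) (zs : seq L) :
  [pchar L] =i pred0 -> (0 < N)%N ->
  'X^N - 1 %| \prod_(z <- zs) ('X - z%:P) -> exists z : L, N.-primitive_root z.
Proof.
move=> charL0 N_gt0 /dvdp_prod_XsubC[m Dm].
have sep : separable_poly ('X^N - 1 : {poly L}).
  rewrite cyclotomic.separable_Xn_sub_1 //; move/pcharf0P: charL0 => ->; by rewrite -lt0n.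
have us : uniq (mask m zs) by rewrite -separable_prod_XsubC -(eqp_separable Dm).
have /hasP[z _ hz] : has N.-primitive_root (mask m zs); last by exists z.
apply: has_prim_root us _ => //.
  apply/allP => z zm; have : root (\prod_(i <- mask m zs) ('X - i%:P)) z by rewrite
    root_prod_XsubC.
  by rewrite -(eqp_root Dm) /root !hornerE subr_eq0 => /eqP ?; apply/unity_rootP.
by rewrite -ltnS -(size_prod_XsubC _ id) -(eqp_size Dm) size_XnsubC.
Qed.

(** The dual group is realized by the linear characters over [algC]. Their values are powers of a
    primitive root [w], which are transported to [L] by sending w^k to zeta^k. *)
Lemma dual_group_exists (L : fieldType) (gT : finGroupType) (zeta : L) :
  abelian [set: gT] -> #|gT|.-primitive_root zeta ->
  exists (hT : finGroupType) (beta : gT -> hT -> L),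
   [/\ forall g g' h, beta (g * g')%g h = beta g h * beta g' h,
       forall g h h', beta g (h * h')%g = beta g h * beta g h',
       forall h, beta 1%g h = 1, forall g, beta g 1%g = 1 &
       (forall g, \sum_h beta g h = (g == 1%g)%:R * #|hT|%:R) /\
       (forall h, \sum_g beta g h = (h == 1%g)%:R * #|hT|%:R)].
Proof.
move=> abG prim; set N := #|gT|.
have N_gt0 : (0 < N)%N by apply/card_gt0P; exists 1%g.
have [w primw] := C_prim_root_exists N_gt0.
have [hT [cF [cFinj cardh cFlin cFonto] [cF1 cFM _ _ _]]] :=
  lin_char_group [group of [set: gT]].
have inG g : g \in [group of [set: gT]] by rewrite inE.
have cFN h g : cF h g ^+ N = 1.
  rewrite -lin_charX // /N -cardsT.
  by rewrite (_ : (g ^+ #|[set: gT]|)%g = 1%g) ?expg_cardG // lin_char1.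
(* Consistent on powers of [w] because [w] and [zeta] have the same order; the value 0 elsewhere is
   a dummy. *)
pose T (c : algC) : L := if [pick k : 'I_N | w ^+ k == c] is Some k then zeta ^+ k else 0.
have TE k : T (w ^+ k) = zeta ^+ k.
  rewrite /T; case: pickP => [i /eqP|/(_ (Ordinal (ltn_pmod k N_gt0)))].
    by move/eqP; rewrite (eq_prim_root_expr primw) -(eq_prim_root_expr prim) => /eqP.
  by rewrite /= (prim_expr_mod primw) eqxx.
have wP h g : exists k, cF h g = w ^+ k.
  by have /(prim_rootP primw)[k ->] := cFN h g; exists k.
pose beta g h := T (cF h g).
have bMl g g' h : beta (g * g')%g h = beta g h * beta g' h.
  rewrite /beta lin_charM //; have [k ->] := wP h g; have [l ->] := wP h g'.
  by rewrite -exprD !TE exprD.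
have bMr g h h' : beta g (h * h')%g = beta g h * beta g h'.
  rewrite /beta cFM cfunE; have [k ->] := wP h g; have [l ->] := wP h' g.
  by rewrite -exprD !TE exprD.
have b1l h : beta 1%g h = 1 by rewrite /beta lin_char1 // -(expr0 w) TE expr0.
have b1r g : beta g 1%g = 1 by rewrite /beta cF1 cfun1E inG -[true%:R](expr0 w) TE expr0.
have b_eq1 g h : beta g h = 1 -> cF h g = 1.
  rewrite /beta; have [k ->] := wP h g; rewrite TE => /eqP.
  by rewrite -(prim_order_dvd prim) (prim_order_dvd primw) => /eqP.
exists hT, beta; split=> //; split=> [g|h].
  have [->|g1] := eqVneq g 1%g.
    by under eq_bigr => h _ do rewrite b1l; rewrite sumr_const mul1r.
  (* Otherwise [g] would lie in the kernel of every linear character, hence in the derived subgroup,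
     which is trivial. *)
  rewrite mul0r; have [h bh] : exists h, beta g h != 1.
    apply/existsP; apply: contraNT g1 => /existsPn H.
    have : g \in ([group of [set: gT]]^`(1))%g.
      rewrite -cap_cfker_lin_irr; apply/bigcapP => i lin_i.
      have [u E] := cFonto _ lin_i.
      rewrite cfkerEchar ?irr_char // inE inG /= E (lin_char1 (cFlin u)).
      by apply/eqP/b_eq1/eqP; rewrite -[_ == _]negbK H.
    by rewrite (derG1P abG) inE.
  (* Translating the summation index by [h] multiplies the sum by [beta g h], which differs from
     1. *)
  apply: (@mulfI _ (beta g h - 1)); first by rewrite subr_eq0.
  rewrite mulr0 mulrBl mul1r mulr_sumr; apply/eqP; rewrite subr_eq0; apply/eqP.
  rewrite [RHS](reindex_inj (mulgI h)) /=.
  by apply: eq_bigr => k _; rewrite bMr.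
have -> : #|hT| = N by rewrite cardh (derG1P abG) indexg1 cardsT.
have [->|h1] := eqVneq h 1%g.
  by under eq_bigr => g _ do rewrite b1r; rewrite sumr_const mul1r.
rewrite mul0r; have [g bg] : exists g, beta g h != 1.
  apply/existsP; apply: contraNT h1 => /existsPn H.
  apply/eqP/cFinj/cfunP => g; rewrite cF1 cfun1E inG /=.
  by apply/b_eq1/eqP; rewrite -[_ == _]negbK H.
apply: (@mulfI _ (beta g h - 1)); first by rewrite subr_eq0.
rewrite mulr0 mulrBl mul1r mulr_sumr; apply/eqP; rewrite subr_eq0; apply/eqP.
rewrite [RHS](reindex_inj (mulgI g)) /=.
by apply: eq_bigr => k _; rewrite bMl.
Qed.

(** * Algebras with a basis of grouplikes *)

Section Grouplikes.
Variables (L : fieldType) (B : falgType L) (X : finType).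
(** The basis elements [b x] play the role of grouplikes: the implicit coproduct of [B] sends [b x]
    to its tensor square, and [co] gives the dual basis. *)
Variables (b : X -> B) (co : X -> B -> L).
Hypothesis co_lin : forall x, scalar (co x).
Hypothesis charL0 : [pchar L] =i pred0.
Hypothesis co_b : forall x y, co x (b y) = (x == y)%:R.
Hypothesis co_sum : forall v, v = \sum_x co x v *: b x.

Implicit Types (S T V : {set X}) (u v : B) (x y z w : X) (s t : {perm X}) (phi : X -> L).

HB.instance Definition _ x := GRing.isLinear.Build L B L *%R (co x) (co_lin x).

Let natL_eq0 n : (n%:R == 0 :> L) = (n == 0)%N.
Proof. by move/pcharf0P: charL0 => ->. Qed.

Let true_neq0 : (true%:R == 0 :> L) = false.
Proof. exact: oner_eq0. Qed.

Lemma co0 x : co x 0 = 0. Proof. exact: linear0. Qed.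
Lemma coZ x k v : co x (k *: v) = k * co x v. Proof. exact: linearZ. Qed.
Lemma coS x I (r : seq I) P F : co x (\sum_(i <- r | P i) F i) = \sum_(i <- r | P i) co x (F i).
Proof. exact: linear_sum. Qed.

Lemma co_ext u v : (forall x, co x u = co x v) -> u = v.
Proof. by move=> uv; rewrite (co_sum u) (co_sum v); apply: eq_bigr => x _; rewrite uv. Qed.

Lemma b_neq0 x : b x != 0.
Proof. by apply/eqP => bx0; have /eqP := co_b x x; rewrite bx0 co0 eqxx eq_sym true_neq0. Qed.

Lemma b_inj : injective b.
Proof.
by move=> x y bxy; apply/eqP; have /eqP := co_b x y; rewrite -bxy co_b eqxx;
  case: (x == y) => //; rewrite true_neq0.
Qed.

Lemma neq0_co v : v != 0 -> exists x, co x v != 0.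
Proof.
move=> v0; apply/existsP; apply: contra_neqT v0 => /existsPn h.
by apply: co_ext => x; rewrite co0; apply/eqP; move/negPn: (h x).
Qed.

(** * Linear extensions, spans of basis elements and diagonal operators *)

Definition lext_fun (f : X -> B) (v : B) : B := \sum_x co x v *: f x.
Fact lext_linear f : linear (lext_fun f).
Proof.
move=> k u v; rewrite /lext_fun scaler_sumr -big_split /=; apply: eq_bigr => x _.
by rewrite linearP scalerDl scalerA.
Qed.
HB.instance Definition _ f := GRing.isLinear.Build L B B _ (lext_fun f) (lext_linear f).
Definition lext f : 'End(B) := linfun (lext_fun f).

Lemma lextE f v : lext f v = \sum_x co x v *: f x.
Proof. by rewrite lfunE. Qed.

Lemma lext_b f x : lext f (b x) = f x.
Proof.
rewrite lextE (bigD1 x) //= co_b eqxx scale1r big1 ?addr0 // => y /negPf yx.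
by rewrite co_b yx scale0r.
Qed.

Lemma lfun_extb (f g : 'End(B)) : (forall x, f (b x) = g (b x)) -> f = g.
Proof.
move=> fg; apply/lfunP => v; rewrite (co_sum v) !linear_sum; apply: eq_bigr => x _.
by rewrite !linearZ /= fg.
Qed.

Definition pext (s : {perm X}) : 'End(B) := lext (fun x => b (s x)).

Lemma pext_b s x : pext s (b x) = b (s x). Proof. exact: lext_b. Qed.

Lemma pext_co (s : {perm X}) x v : co (s x) (pext s v) = co x v.
Proof.
rewrite lextE coS (bigD1 x) //= coZ co_b eqxx mulr1 big1 ?addr0 => [//|y yx].
by rewrite coZ co_b (inj_eq perm_inj) eq_sym (negPf yx) mulr0.
Qed.

Lemma pextM s t v : pext (s * t) v = pext t (pext s v).
Proof.
rewrite -comp_lfunE; congr (fun_of_lfun _ v); apply: lfun_extb => x.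
by rewrite comp_lfunE !pext_b permM.
Qed.

Lemma pext1 v : pext 1 v = v.
Proof.
rewrite -[RHS]id_lfunE; congr (fun_of_lfun _ v); apply: lfun_extb => x.
by rewrite id_lfunE pext_b perm1.
Qed.

Lemma pext_mul s : (forall x y, pext s (b x * b y) = b (s x) * b (s y)) ->
  forall u v, pext s (u * v) = pext s u * pext s v.
Proof.
move=> sM u v; rewrite (co_sum u) mulr_suml !linear_sum mulr_suml; apply: eq_bigr => x _.
rewrite -scalerAl !linearZ /= -scalerAl; congr (_ *: _).
rewrite (co_sum v) mulr_sumr !linear_sum mulr_sumr; apply: eq_bigr => y _.
by rewrite -scalerAr !linearZ /= -scalerAr sM !pext_b.
Qed.

Definition gspan (S : {set X}) : {vspace B} := <<[seq b x | x in S]>>%VS.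

Lemma mem_gspanP S v : reflect (forall x, x \notin S -> co x v = 0) (v \in gspan S).
Proof.
apply: (iffP idP) => [|h].
  move=> /coord_span -> x xS; rewrite coS big1 // => i _; rewrite coZ.
  have /imageP[y yS E] : [seq b x | x in S]`_i \in [seq b x | x in S].
    by apply: mem_nth; rewrite size_image.
  rewrite [_`_i]E.
  rewrite co_b; suff /negPf-> : x != y by rewrite mulr0.
  by apply: contraNneq xS => ->.
rewrite (co_sum v); apply: memv_suml => x _.
have [xS|/h->] := boolP (x \in S); last by rewrite scale0r mem0v.
by rewrite memvZ // memv_span //; apply/imageP; exists x.
Qed.

Lemma mem_gspan_b S x : (b x \in gspan S) = (x \in S).
Proof.
apply/mem_gspanP/idP => [h|xS y yS]; last by rewrite co_b; case: eqP yS xS => // -> /negPf->.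
by apply/negPn/negP => /h/eqP; rewrite co_b eqxx true_neq0.
Qed.

Lemma sub_gspan S T : S \subset T -> (gspan S <= gspan T)%VS.
Proof.
move=> sST; apply/subvP => v /mem_gspanP h; apply/mem_gspanP => x xT; apply: h.
by apply: contra xT; apply: (subsetP sST).
Qed.

Lemma sum_gspan S v : v \in gspan S -> v = \sum_(x in S) co x v *: b x.
Proof.
move=> /mem_gspanP h; rewrite [LHS]co_sum [RHS]big_mkcond; apply: eq_bigr => x _.
by case: ifP => // /negbT/h ->; rewrite scale0r.
Qed.

Lemma lin_gspan S (f : 'End(B)) (V : {vspace B}) :
  (forall x, x \in S -> f (b x) \in V) -> forall v, v \in gspan S -> f v \in V.
Proof.
move=> h v /sum_gspan ->; rewrite linear_sum; apply: memv_suml => x xS.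
by rewrite linearZ memvZ ?h.
Qed.

Lemma dim_gspan S : \dim (gspan S) = #|S|.
Proof.
have fr : free [seq b x | x in S].
  apply/freeP => k /= h i; have := congr1 (co (enum_val i)) h.
  rewrite co0 coS (bigD1 i) //= coZ nth_image co_b eqxx mulr1 big1 ?addr0 // => j ji.
  by rewrite coZ nth_image co_b (inj_eq enum_val_inj) eq_sym (negPf ji) mulr0.
by rewrite (eqP fr) size_image.
Qed.

Lemma pext_gspan (s : {perm X}) S : (forall x, x \in S -> s x \in S) ->
  forall v, v \in gspan S -> pext s v \in gspan S.
Proof. by move=> h; apply: lin_gspan => x xS; rewrite pext_b mem_gspan_b h. Qed.

(** Functions on [X] form the algebra dual to the coalgebra [B]: [diagop phi] is the coproduct
    followed by [phi] on one factor, and [pairing phi] is the linear extension of [phi]. *)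
Definition diagop (phi : X -> L) : 'End(B) := lext (fun x => phi x *: b x).
Definition pairing (phi : X -> L) (v : B) : L := \sum_w phi w * co w v.

Lemma co_diagop phi v x : co x (diagop phi v) = phi x * co x v.
Proof.
rewrite lextE coS (bigD1 x) //= !coZ co_b eqxx big1 ?addr0 => [|y yx].
  by rewrite mulr1 mulrC.
by rewrite !coZ co_b eq_sym (negPf yx) !mulr0.
Qed.

Definition dirac_fun (z : X) : X -> L := fun w => (w == z)%:R.

Lemma diagop_dirac z v : diagop (dirac_fun z) v = co z v *: b z.
Proof.
apply: co_ext => x; rewrite co_diagop coZ co_b /dirac_fun.
by case: eqP => [->|_]; rewrite ?mul1r ?mul0r ?mulr1 ?mulr0.
Qed.

Lemma pairing_dirac z v : pairing (dirac_fun z) v = co z v.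
Proof.
rewrite /pairing (bigD1 z) //= /dirac_fun eqxx mul1r big1 ?addr0 // => w /negPf->.
by rewrite mul0r.
Qed.

Lemma pairingE (f : B -> L) : scalar f -> forall v, pairing (f \o b) v = f v.
Proof.
move=> flin v; pose fl : {scalar B} := HB.pack f (GRing.isLinear.Build L B L *%R f flin).
rewrite -[f v]/(fl v) {2}(co_sum v) linear_sum; apply: eq_bigr => w _.
by rewrite linearZ mulrC.
Qed.

(* [rho] is the action of G, [tau] that of the dual group of G, encoded as an
   arbitrary group [hT] with a perfect pairing [beta]. *)
Section Braided.
Variables (e0 : X) (gT hT : finGroupType) (rho : gT -> {perm X}) (tau : hT -> {perm X}).
Variable beta : gT -> hT -> L.
Hypothesis b_e0 : b e0 = 1.
Hypothesis b_unit : forall x, b x \is a GRing.unit.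
Hypothesis rhoM : {morph rho : g h / (g * h)%g}.
Hypothesis tauM : {morph tau : g h / (g * h)%g}.
Hypothesis betaMl : forall g g' h, beta (g * g')%g h = beta g h * beta g' h.
Hypothesis betaMr : forall g h h', beta g (h * h')%g = beta g h * beta g h'.
Hypothesis beta1l : forall h, beta 1%g h = 1.
Hypothesis beta1r : forall g, beta g 1%g = 1.
Hypothesis orth_l : forall g, \sum_h beta g h = (g == 1%g)%:R * #|hT|%:R.
Hypothesis orth_r : forall h, \sum_g beta g h = (h == 1%g)%:R * #|hT|%:R.

(** The automorphisms of the whole structure: since they permute the grouplikes, they respect the
    coproduct automatically. *)
Definition ydaut : {set {perm X}} :=
  [set s | [&& [forall g, (s * rho g)%g == (rho g * s)%g], [forall h,
    (s * tau h)%g == (tau h * s)%g]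
   & [forall x, forall y, pext s (b x * b y) == b (s x) * b (s y)]]].

Hypothesis rho_aut : forall g, rho g \in ydaut.
Hypothesis tau_aut : forall h, tau h \in ydaut.

Lemma ydaut_rho s g x : s \in ydaut -> s (rho g x) = rho g (s x).
Proof. by rewrite inE => /and3P[/forallP/(_ g)/eqP/permP/(_ x)]; rewrite !permM. Qed.

Lemma ydaut_tau s h x : s \in ydaut -> s (tau h x) = tau h (s x).
Proof. by rewrite inE => /and3P[_ /forallP/(_ h)/eqP/permP/(_ x)]; rewrite !permM. Qed.

Lemma ydaut_mul s u v : s \in ydaut -> pext s (u * v) = pext s u * pext s v.
Proof.
rewrite inE => /and3P[_ _ /forallP h]; apply: pext_mul => x y.
by apply/eqP/(forallP (h x)).
Qed.

Lemma rho1 : rho 1%g = 1%g.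
Proof. by apply: (mulgI (rho 1%g)); rewrite -rhoM !mulg1. Qed.
Lemma tau1 : tau 1%g = 1%g.
Proof. by apply: (mulgI (tau 1%g)); rewrite -tauM !mulg1. Qed.

Lemma ydautM s t : s \in ydaut -> t \in ydaut -> (s * t)%g \in ydaut.
Proof.
move=> sA tA; rewrite inE; apply/and3P; split; last first.
- apply/forallP => x; apply/forallP => y.
  by rewrite pextM !ydaut_mul // !pext_b !permM.
- by apply/forallP => h; apply/eqP/permP => x; rewrite !permM !ydaut_tau.
- by apply/forallP => g; apply/eqP/permP => x; rewrite !permM !ydaut_rho.
Qed.

(** * The grading by [gT], recovered from the action of its dual group *)

Lemma betaV g h : (beta g h)^-1 = beta g^-1%g h.
Proof.
have E : beta g h * beta g^-1%g h = 1 by rewrite -betaMl mulgV beta1l.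
have b0 : beta g h != 0 by apply/eqP => b0; move/eqP: E; rewrite b0 mul0r eq_sym oner_eq0.
by apply: (mulfI b0); rewrite E divff.
Qed.

Lemma beta_neq0 g h : beta g h != 0.
Proof. by apply/eqP => b0; have /eqP := beta1l h;
  rewrite -(mulgV g) betaMl b0 mul0r eq_sym oner_eq0. Qed.

Lemma cardhT_neq0 : (#|hT|%:R : L) != 0.
Proof. by rewrite natL_eq0 -lt0n; apply/card_gt0P; exists 1%g. Qed.

(** Projection onto the component of degree [g], the isotypic part for the character [beta g] of
    [hT]. *)
Definition wcomp (g : gT) : 'End(B) :=
  #|hT|%:R^-1 *: \sum_h (beta g h)^-1 *: pext (tau h).

Lemma wcompE g v : wcomp g v = #|hT|%:R^-1 *: \sum_h (beta g h)^-1 *: pext (tau h) v.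
Proof.
rewrite scale_lfunE sum_lfunE; congr (_ *: _).
by apply: eq_bigr => h _; rewrite scale_lfunE.
Qed.

Definition homogeneous (g : gT) (v : B) := forall h, pext (tau h) v = beta g h *: v.

Lemma wcomp_is_homog g v : homogeneous g (wcomp g v).
Proof.
move=> h; rewrite wcompE linearZ /= scalerA [_ * _]mulrC -scalerA; congr (_ *: _).
rewrite linear_sum scaler_sumr (reindex_inj (mulIg h^-1%g)); apply: eq_bigr => k _.
rewrite linearZ /= -pextM -tauM mulgKV scalerA; congr (_ *: _).
have -> : beta g k = beta g (k * h^-1)%g * beta g h by rewrite -betaMr mulgKV.
by rewrite invfM mulrCA mulfV ?mulr1 // beta_neq0.
Qed.

Lemma wcomp_homog g k v : homogeneous g v -> wcomp k v = (k == g)%:R *: v.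
Proof.
move=> hv; rewrite wcompE.
under eq_bigr => h _ do rewrite hv scalerA betaV -betaMl.
rewrite -scaler_suml scalerA orth_l mulrCA mulVf ?cardhT_neq0 // mulr1.
by rewrite -eq_mulVg1.
Qed.

Lemma wcomp_sum v : \sum_g wcomp g v = v.
Proof.
under eq_bigr => g _ do rewrite wcompE.
rewrite -scaler_sumr exchange_big /=.
under eq_bigr => h _.
  rewrite -scaler_suml (reindex_inj invg_inj) /=.
  under eq_bigr => g _ do rewrite betaV invgK.
  rewrite orth_r; over.
rewrite (bigD1 1%g) //= eqxx mul1r tau1 pext1 big1 ?addr0 => [|h /negPf->].
  by rewrite scalerA mulVf ?cardhT_neq0 // scale1r.
by rewrite mul0r scale0r.
Qed.

Lemma homogM g k u v : homogeneous g u -> homogeneous k v -> homogeneous (g * k)%g (u * v).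
Proof.
move=> hu hv h; rewrite ydaut_mul // hu hv -scalerAl -scalerAr scalerA.
by rewrite betaMl.
Qed.

Definition gdeg (x : X) : {set gT} := [set g | wcomp g (b x) != 0].

(** The degrees of [x] are the annihilator of its stabilizer in [hT]. A stabilizing [h] acts on the
    degree [g] part both by [beta g h] and trivially. Conversely, the coefficient of that part at
    [x] is the order of the stabilizer divided by that of [hT], which is nonzero in characteristic
    zero. *)
Lemma gdegP g x : reflect (forall h, tau h x = x -> beta g h = 1) (g \in gdeg x).
Proof.
rewrite inE; apply: (iffP idP) => [nz h hx|h].
  have := wcomp_is_homog g (b x) h; rewrite wcompE linearZ linear_sum /=.
  have -> : \sum_k pext (tau h) ((beta g k)^-1 *: pext (tau k) (b x))
     = \sum_k (beta g k)^-1 *: pext (tau k) (b x).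
    apply: eq_bigr => k _; rewrite linearZ /= !pext_b ydaut_tau // hx //.
  rewrite -wcompE => /eqP; rewrite -subr_eq0 -{1}[wcomp g (b x)]scale1r -scalerBl.
  by rewrite scaler_eq0 (negPf nz) orbF subr_eq0 => /eqP.
apply/eqP => /(congr1 (co x))/eqP; rewrite co0 wcompE coZ coS.
rewrite mulf_eq0 invr_eq0 (negPf cardhT_neq0) /=.
have -> : \sum_k co x ((beta g k)^-1 *: pext (tau k) (b x)) = #|[set k | tau k x == x]|%:R.
  rewrite -sum1_card natr_sum [RHS]big_mkcond; apply: eq_bigr => k _.
  rewrite coZ pext_b co_b inE [x == _]eq_sym; case: eqP => [/h->|_]; last by rewrite mulr0.
  by rewrite invr1 mulr1.
rewrite natL_eq0 cards_eq0 => /eqP/setP/(_ 1%g); rewrite !inE tau1 perm1 eqxx //.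
Qed.

Lemma gdegX g x n : g \in gdeg x -> (g ^+ n)%g \in gdeg x.
Proof.
move=> /gdegP gx; apply/gdegP => h /gx; elim: n => [|n IH] gh; first by rewrite expg0 beta1l.
by rewrite expgS betaMl gh IH // mul1r.
Qed.

Lemma wcomp_out g x : g \notin gdeg x -> wcomp g (b x) = 0.
Proof. by rewrite inE negbK => /eqP. Qed.

(* Delta (x y) = sum_g x (g y) (x) x_g y, read off at the basis element z (x) w. *)
Hypothesis delta : forall x y z w, (z == w)%:R * co z (b x * b y) =
  \sum_g co z (b x * b (rho g y)) * co w (wcomp g (b x) * b y).

(** Apply [phi] to the second tensor factor of the coproduct of the product. *)
Lemma diagop_mul_r phi x y : diagop phi (b x * b y) =
  \sum_g pairing phi (wcomp g (b x) * b y) *: (b x * b (rho g y)).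
Proof.
apply: co_ext => z; rewrite co_diagop coS.
transitivity (\sum_w phi w * ((z == w)%:R * co z (b x * b y))).
  rewrite (bigD1 z) //= eqxx mul1r big1 ?addr0 // => w /negPf wz.
  by rewrite eq_sym wz mul0r mulr0.
under eq_bigr => w _ do rewrite delta mulr_sumr.
rewrite exchange_big; apply: eq_bigr => g _; rewrite coZ /pairing mulr_suml.
by apply: eq_bigr => w _; rewrite mulrCA mulrC -mulrA mulrCA mulrA.
Qed.

(** Here [phi] is applied to the first tensor factor, which leaves an expansion along the components
    of [x]. *)
Lemma diagop_mul_l phi x y : diagop phi (b x * b y) =
  \sum_g pairing phi (b x * b (rho g y)) *: (wcomp g (b x) * b y).
Proof.
apply: co_ext => z; rewrite co_diagop coS.
transitivity (\sum_w phi w * ((w == z)%:R * co w (b x * b y))).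
  rewrite (bigD1 z) //= eqxx mul1r big1 ?addr0 // => w /negPf wz.
  by rewrite wz mul0r mulr0.
under eq_bigr => w _ do rewrite delta mulr_sumr.
rewrite exchange_big; apply: eq_bigr => g _; rewrite coZ /pairing mulr_suml.
by apply: eq_bigr => w _; rewrite mulrA.
Qed.

Hypothesis eps1 : forall x y, \sum_z co z (b x * b y) = 1.

(** * Closed subsets, whose spans are the stable graded Hopf subalgebras, and their cosets *)

Record hopf_closed (S : {set X}) : Prop := Closed {
  closed1 : e0 \in S;
  closed_rho : forall g x, x \in S -> rho g x \in S;
  closed_tau : forall h x, x \in S -> tau h x \in S;
  closed_mul : forall x y, x \in S -> y \in S -> b x * b y \in gspan S }.

Lemma gspan_mul S u v : hopf_closed S -> u \in gspan S -> v \in gspan S -> u * v \in gspan S.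
Proof.
move=> cS /sum_gspan-> /sum_gspan->; rewrite mulr_suml; apply: memv_suml => x xS.
rewrite mulr_sumr; apply: memv_suml => y yS.
by rewrite -scalerAl -scalerAr !memvZ // closed_mul.
Qed.

(** Left multiplication by [u] is injective on the finite-dimensional span, hence surjective, so it
    reaches 1. *)
Lemma gspan_inv S u : hopf_closed S -> u \in gspan S -> u \is a GRing.unit -> u^-1 \in gspan S.
Proof.
move=> cS uS uU.
have E : (amull u @: gspan S)%VS = gspan S.
  apply/eqP; rewrite eqEdim limg_dim_eq ?leqnn ?andbT.
    apply/subvP => _ /memv_imgP[v vS ->]; rewrite lfunE.
    exact: gspan_mul.
  suff /eqP-> : lker (amull u) == 0%VS by rewrite capv0.
  by apply/lker0P => v v'; rewrite !lfunE /= => /(mulrI uU).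
have : b e0 \in (amull u @: gspan S)%VS by rewrite E mem_gspan_b closed1.
case/memv_imgP => v vS; rewrite lfunE b_e0 /= => uv1.
by rewrite -(mulr1 u^-1) uv1 mulKr.
Qed.

Lemma mul_b_neq0 x v : v != 0 -> b x * v != 0.
Proof. by apply: contraNneq => bv; rewrite -(mulKr (b_unit x) v) bv mulr0. Qed.

Definition fixpts (E : {set {perm X}}) (S : {set X}) :=
  [set z in S | [forall s in E, s z == z]].

Lemma fixptsP (E : {set {perm X}}) S z :
  reflect (z \in S /\ forall s, s \in E -> s z = z) (z \in fixpts E S).
Proof.
rewrite inE; apply: (iffP andP) => -[zS h]; split=> //.
  by move=> s sE; apply/eqP/(forall_inP h).
by apply/forall_inP => s sE; rewrite h.
Qed.

Lemma fixpts_sub (E : {set {perm X}}) S : fixpts E S \subset S.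
Proof. by apply/subsetP => z /fixptsP[]. Qed.

Lemma b_diagop z v : co z v != 0 -> b z = (co z v)^-1 *: diagop (dirac_fun z) v.
Proof. by move=> nz; rewrite diagop_dirac scalerA mulVf ?scale1r. Qed.

Lemma ydaut_e0 s : s \in ydaut -> s e0 = e0.
Proof.
move=> sA; apply: b_inj; rewrite -pext_b b_e0.
rewrite -[LHS](mulKr (b_unit (s e0))) -pext_b b_e0 -ydaut_mul // mul1r.
by rewrite -b_e0 pext_b mulVr.
Qed.

(** Closure under products: for [z] in the support of x y, [b z] is a multiple of
    [diagop (dirac_fun z)] applied to x y, hence a combination of products [b x * b (rho g y)], each
    of which is fixed by [s]. *)
Lemma closed_fixpts (E : {set {perm X}}) S :
  E \subset ydaut -> hopf_closed S -> hopf_closed (fixpts E S).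
Proof.
move=> /subsetP EA cS; split.
- by apply/fixptsP; split=> [|s /EA]; [apply: closed1 | apply: ydaut_e0].
- move=> g x /fixptsP[xS xE]; apply/fixptsP; split=> [|s sE]; first exact: closed_rho.
  by rewrite ydaut_rho ?EA // xE.
- move=> g x /fixptsP[xS xE]; apply/fixptsP; split=> [|s sE]; first exact: closed_tau.
  by rewrite ydaut_tau ?EA // xE.
move=> x y /fixptsP[xS xE] /fixptsP[yS yE]; apply/mem_gspanP => z.
apply: contraNeq => nz; apply/fixptsP; split.
  by apply: contraNT nz => zS; apply/eqP; move/mem_gspanP: (closed_mul cS xS yS); apply.
move=> s sE; have sA := EA s sE; apply: b_inj; rewrite -pext_b (b_diagop nz) linearZ /=.
congr (_ *: _); rewrite diagop_mul_r linear_sum; apply: eq_bigr => g _.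
by rewrite linearZ /= ydaut_mul // !pext_b xE // ydaut_rho // yE.
Qed.

(* The support of x (gspan S); it has as many elements as S, and these sets
   partition X. *)
Definition gcoset x S : {set X} := [set z | b z \in (amull (b x) @: gspan S)%VS].

Lemma mem_gcosetP x S z : reflect (exists2 v, v \in gspan S & b z = b x * v) (z \in gcoset x S).
Proof.
rewrite inE; apply: (iffP memv_imgP) => -[v vS E]; exists v => //; first by rewrite E lfunE.
by rewrite lfunE.
Qed.

(** By [diagop_mul_r] the translate is stable under all operators [diagop phi], so it is spanned by
    the basis elements it contains. *)
Lemma gspan_gcoset x S : hopf_closed S -> gspan (gcoset x S) = (amull (b x) @: gspan S)%VS.
Proof.
move=> cS; apply/eqP; rewrite eqEsubv; apply/andP; split.
  apply/span_subvP => _ /imageP[z zC ->]; by rewrite inE in zC.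
apply/subvP => _ /memv_imgP[v vS ->]; apply/mem_gspanP => z.
apply: contraNeq => nz; rewrite inE (b_diagop nz); apply: memvZ.
rewrite [amull _ _]lfunE /= {1}(sum_gspan vS) mulr_sumr linear_sum; apply: memv_suml => y yS.
rewrite -scalerAr linearZ memvZ //= diagop_mul_r; apply: memv_suml => g _.
rewrite memvZ //; apply/memv_imgP; exists (b (rho g y)); last by rewrite lfunE.
by rewrite mem_gspan_b closed_rho.
Qed.

Lemma lker_amull x : lker (amull (b x)) = 0%VS.
Proof. by apply/eqP/lker0P => v v'; rewrite !lfunE /= => /(mulrI (b_unit x)). Qed.

Lemma card_gcoset x S : hopf_closed S -> #|gcoset x S| = #|S|.
Proof. by move=> cS; rewrite -!dim_gspan gspan_gcoset // limg_dim_eq // lker_amull capv0. Qed.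

Lemma gcoset_refl x S : hopf_closed S -> x \in gcoset x S.
Proof.
move=> cS; apply/mem_gcosetP; exists 1; rewrite ?mulr1 //.
by rewrite -b_e0 mem_gspan_b closed1.
Qed.

Lemma gcoset_eq x z S : hopf_closed S -> z \in gcoset x S -> gcoset z S = gcoset x S.
Proof.
move=> cS /mem_gcosetP[v vS zE]; apply/eqP; rewrite eqEcard !card_gcoset // leqnn andbT.
apply/subsetP => w /mem_gcosetP[v' v'S wE]; apply/mem_gcosetP.
by exists (v * v'); rewrite ?gspan_mul // wE zE mulrA.
Qed.

Lemma gcoset_sub x S T : hopf_closed S -> T \subset S -> x \in S -> gcoset x T \subset S.
Proof.
move=> cS sTS xS; apply/subsetP => z /mem_gcosetP[v vT zE].
by rewrite -mem_gspan_b zE gspan_mul ?mem_gspan_b // (subvP (sub_gspan sTS)).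
Qed.

(** Lagrange's theorem: the cosets of [T] all have the size of [T] and partition [S]. *)
Lemma dvdn_card_closed S T : hopf_closed S -> hopf_closed T -> T \subset S -> (#|T| %| #|S|)%N.
Proof.
move=> cS cT sTS; pose P := [set gcoset x T | x in S].
have partP : partition P S.
  apply/and3P; split.
  - rewrite eqEsubset; apply/andP; split.
      by apply/bigcupsP => _ /imsetP[x xS ->]; apply: gcoset_sub.
    apply/subsetP => x xS; apply/bigcupP; exists (gcoset x T); first exact: imset_f.
    exact: gcoset_refl.
  - apply/trivIsetP => _ _ /imsetP[x xS ->] /imsetP[y yS ->]; apply: contraR.
    rewrite -setI_eq0 => /set0Pn[z /setIP[zx zy]].
    by rewrite -(gcoset_eq cT zx) (gcoset_eq cT zy).
  by apply/negP => /imsetP[x xS /setP/(_ x)]; rewrite gcoset_refl // inE.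
rewrite (card_uniform_partition (n := #|T|) _ partP) ?dvdn_mull //.
by move=> _ /imsetP[x xS ->]; rewrite card_gcoset.
Qed.

Lemma pext_gcoset s x S : s \in ydaut -> (forall z, z \in S -> s z \in S) -> hopf_closed S ->
  forall z, z \in gcoset x S -> s z \in gcoset (s x) S.
Proof.
move=> sA sS cS z /mem_gcosetP[v vS zE]; apply/mem_gcosetP; exists (pext s v).
  exact: pext_gspan.
by rewrite -!pext_b zE ydaut_mul.
Qed.

(** * Compatible pairs and trivial braiding *)

Definition compatible x y := forall g, g \in gdeg x -> rho g y = y.

(** Compatibility collapses the twisted coproduct formula, so the product is grouplike: every
    [diagop phi] scales it. Taking for [phi] the Dirac function of a support point identifies it
    with the basis element there. *)
Lemma mul_compatible x y : compatible x y -> exists z, b x * b y = b z.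
Proof.
move=> cxy.
have DE phi : diagop phi (b x * b y) = pairing phi (b x * b y) *: (b x * b y).
  have exy : b x * b y = \sum_g wcomp g (b x) * b y by rewrite -mulr_suml wcomp_sum.
  rewrite diagop_mul_r [X in _ = pairing _ X *: _]exy.
  have evS : pairing phi (\sum_g wcomp g (b x) * b y) =
    \sum_g pairing phi (wcomp g (b x) * b y).
    rewrite /pairing exchange_big; apply: eq_bigr => w _.
    by rewrite coS mulr_sumr.
  rewrite evS scaler_suml; apply: eq_bigr => g _.
  have [/cxy-> //|/wcomp_out->] := boolP (g \in gdeg x); rewrite mul0r.
  by rewrite /pairing big1 ?scale0r // => w _; rewrite co0 mulr0.
have [z nz] := neq0_co (mul_b_neq0 x (b_neq0 y)).
have := DE (dirac_fun z); rewrite diagop_dirac pairing_dirac => /eqP.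
by exists z; apply: (scalerI nz); apply/esym/eqP.
Qed.

Definition braid_trivial S := forall x y, x \in S -> y \in S -> compatible x y.

Lemma trivial_mul S x y : hopf_closed S -> braid_trivial S -> x \in S -> y \in S ->
  exists2 z, z \in S & b x * b y = b z.
Proof.
move=> cS tS xS yS; have [z E] := mul_compatible (tS x y xS yS).
by exists z; rewrite // -mem_gspan_b -E closed_mul.
Qed.

(** * The trace identity *)

Definition gsum S : B := \sum_(x in S) b x.

(* The degree [g] component of an identity for the trace of [diagop phi] on
   [gspan S], which does not change under conjugation by [b x]. *)
Lemma wcomp_trace S x g : hopf_closed S -> x \in S -> g != 1%g ->
  wcomp g (b x) * gsum (fixpts [set rho g] S) = 0.
Proof.
move=> cS xS g1.
pose t k := gsum (fixpts [set rho k] S).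
(* Both sides are the trace on [gspan S] of the conjugate of [diagop phi] by [b x]. By
   [diagop_mul_r] this operator sends [b y] to a combination of the [b (rho k y)], which meets the
   diagonal only where [rho k] fixes [y]. *)
have tr phi : \sum_(z in S) phi z = \sum_k pairing phi (wcomp k (b x) * t k).
  have xVS : (b x)^-1 \in gspan S by rewrite gspan_inv ?mem_gspan_b.
  transitivity (\sum_(y in S) co y ((b x)^-1 * diagop phi (b x * b y))).
    under [RHS]eq_bigr => y yS.
      rewrite /diagop lextE mulr_sumr coS.
      under eq_bigr => z _ do rewrite -!scalerAr !coZ.
      over.
    rewrite exchange_big /= [LHS]big_mkcond; apply: eq_bigr => z _.
    case: ifP => zS; last first.
      rewrite big1 // => y yS; move/mem_gspanP: (closed_mul cS xS yS) => ->;
        first by rewrite mul0r.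
      by rewrite zS.
    transitivity (phi z * co z (b x * ((b x)^-1 * b z))).
      by rewrite mulVKr // co_b eqxx mulr1.
    have /sum_gspan {1}-> : (b x)^-1 * b z \in gspan S by rewrite gspan_mul ?mem_gspan_b.
    rewrite mulr_sumr coS mulr_sumr; apply: eq_bigr => y yS.
    by rewrite -scalerAr coZ [RHS]mulrC [LHS]mulrA.
  under eq_bigr => y yS.
    rewrite diagop_mul_r mulr_sumr coS.
    under eq_bigr => k _ do rewrite -scalerAr mulKr // coZ co_b.
    over.
  rewrite exchange_big /=; apply: eq_bigr => k _.
  rewrite /t /gsum mulr_sumr /pairing.
  under [RHS]eq_bigr => w _ do rewrite coS mulr_sumr.
  rewrite [RHS]exchange_big /= [LHS](bigID (fun y => rho k y == y)) /=.
  rewrite [X in _ + X]big1 ?addr0 => [|y /andP[_ /negPf ky]]; last first.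
    by rewrite eq_sym ky mulr0.
  apply: eq_big => [y|y /andP[_ /eqP->]]; last by rewrite eqxx mulr1.
  apply/andP/fixptsP => [[yS /eqP ky]|[yS h]]; split=> //; first by move=> s /set1P->.
  by rewrite h ?inE.
(* Coordinate by coordinate, with Dirac functions for [phi]. *)
have tE : gsum S = \sum_k wcomp k (b x) * t k.
  apply: co_ext => z; rewrite coS /gsum coS.
  transitivity (\sum_(y in S) dirac_fun z y).
    by apply: eq_bigr => y _; rewrite co_b /dirac_fun eq_sym.
  by rewrite tr; apply: eq_bigr => k _; rewrite pairing_dirac.
(* The dual group permutes the summands, so sums over closed sets have degree 1. Hence the summands
   of [tE] have degree [k], and its degree [g] part is the claim. *)
have onesH T : hopf_closed T -> homogeneous 1%g (gsum T).
  move=> cT h; rewrite beta1l scale1r /gsum linear_sum.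
  rewrite (reindex_inj (@perm_inj _ (tau h^-1%g))) /=; apply: eq_big => y.
    apply/idP/idP => [yT|]; last exact: closed_tau.
    rewrite -[y]perm1 -tau1 -(mulVg h) tauM permM; exact: closed_tau.
  by move=> _; rewrite pext_b -permM -tauM mulVg tau1 perm1.
have cF k : hopf_closed (fixpts [set rho k] S) by apply: closed_fixpts; rewrite ?sub1set.
have hk k : homogeneous k (wcomp k (b x) * t k).
  by rewrite -[k in homogeneous k]mulg1; apply: homogM; [apply: wcomp_is_homog | apply: onesH].
have := congr1 (wcomp g) tE; rewrite (wcomp_homog g (onesH S cS)) (negPf g1) scale0r linear_sum.
rewrite (bigD1 g) //= (wcomp_homog _ (hk g)) eqxx scale1r big1 ?addr0 => [<- //|k kg].
by rewrite (wcomp_homog _ (hk k)) eq_sym (negPf kg) scale0r.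
Qed.

(** * Elements of prime power order and stabilizers *)

Lemma perm_fix_exists (p : nat) (s : {perm X}) (T : {set X}) : (p.-elt s)%g ->
  (forall z, z \in T -> s z \in T) -> ~~ (p %| #|T|)%N -> exists2 z, z \in T & s z = z.
Proof.
move=> ps sT pT.
have acts : [acts <[s]>%g, on T | 'P].
  by rewrite cycle_subG !inE; apply/subsetP => z zT; rewrite inE /=; apply: sT.
have := pgroup_fix_mod ps acts; rewrite afix_cycle => E.
have : #|('Fix_(T | 'P)[s])%g| != 0%N.
  by apply: contraNneq pT => F0; rewrite /dvdn E F0 mod0n.
rewrite cards_eq0 => /set0Pn[z /setIP[zT /afix1P zs]].
by exists z.
Qed.

(** The primary constituents of [g] are powers of [g], hence degrees of [x], and their product is
    [g]; if all of them fixed [y], so would [g]. *)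
Lemma gdeg_p_elt x y g : g \in gdeg x -> rho g y != y ->
  exists p, exists2 h, [/\ prime p,
    (p %| #|gT|)%N & (p.-elt h)%g] & h \in gdeg x /\ rho h y != y.
Proof.
move=> gx gy.
have : ~~ [forall p : 'I_(#[g]%g.+1), rho (g.`_p)%g y == y].
  apply: contra gy => /forallP h; rewrite -[g]prod_constt big_mkord.
  apply/eqP; elim/big_ind: _ => [|k l ky ly|i _]; first by rewrite rho1 perm1.
    by rewrite rhoM permM ky.
  exact/eqP.
case/forallPn => p py; exists p, (g.`_p)%g; last first.
  by split=> //; rewrite /constt gdegX.
have ph : ((p : nat).-elt (g.`_p))%g by apply: p_elt_constt.
(* A nontrivial constituent forces the index [p] to be a prime divisor of its order. *)
have h1 : (1 < #[g.`_p]%g)%N.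
  by rewrite order_gt1; apply: contraNneq py => ->; rewrite rho1 perm1.
have pr_q : prime (pdiv #[g.`_p]%g) by apply: pdiv_prime.
have := pnatP _ (ltnW h1) ph _ pr_q (pdiv_dvd _); rewrite inE => /eqP E.
split=> //; first by rewrite -E.
by rewrite -E (dvdn_trans (pdiv_dvd _)) // -cardsT order_dvdG ?inE.
Qed.

Lemma constt_fix (p : nat) (s : {perm X}) x : s x = x -> (s.`_p)%g x = x.
Proof.
move=> sx; rewrite /constt; elim: chinese => [|n IH]; first by rewrite expg0 perm1.
by rewrite expgS permM sx.
Qed.

Lemma ydaut1 : 1%g \in ydaut.
Proof. by rewrite -rho1. Qed.

Lemma constt_ydaut (p : nat) s : s \in ydaut -> (s.`_p)%g \in ydaut.
Proof.
move=> sA; rewrite /constt; elim: chinese => [|n IH]; first by rewrite expg0 ydaut1.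
by rewrite expgS ydautM.
Qed.

Lemma pext_unit s u : s \in ydaut -> u \is a GRing.unit -> pext s u \is a GRing.unit.
Proof.
move=> sA uU; have E1 : pext s 1 = 1 by rewrite -b_e0 pext_b ydaut_e0.
by apply/unitrP; exists (pext s u^-1); rewrite -!ydaut_mul // mulVr ?mulrV.
Qed.

Definition gstab x := [set s in ydaut | s x == x].

Lemma stab_sub x : gstab x \subset ydaut.
Proof. by apply/subsetP => s; rewrite inE => /andP[]. Qed.

Lemma mem_fixpts_gstab x S : x \in S -> x \in fixpts (gstab x) S.
Proof. by move=> xS; apply/fixptsP; split=> // s; rewrite inE => /andP[_ /eqP]. Qed.

(** Left multiplication by [b y] permutes [S], so it reaches the unit [e0]; the default value in [f]
    does not occur on [S]. *)
Lemma trivial_inv S y : hopf_closed S -> braid_trivial S -> y \in S ->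
  exists2 y', y' \in S & (b y)^-1 = b y'.
Proof.
move=> cS tS yS.
pose f (v : X) := odflt e0 [pick z | b z == b y * b v].
have fE (v : X) : v \in S -> b (f v) = b y * b v.
  move=> vS; rewrite /f; case: pickP => [z /eqP //|h].
  by have [z _ E] := trivial_mul cS tS yS vS; have := h z; rewrite E eqxx.
have finj : {in S &, injective f}.
  by move=> v v' vS v'S /(congr1 b); rewrite !fE // => /(mulrI (b_unit y))/b_inj.
have fS : f @: S = S.
  apply/eqP; rewrite eqEcard card_in_imset // leqnn andbT; apply/subsetP => _ /imsetP[v vS ->].
  by rewrite -mem_gspan_b fE // closed_mul.
have : e0 \in f @: S by rewrite fS closed1.
case/imsetP => y' y'S /(congr1 b); rewrite fE // b_e0 => E.
by exists y' => //; rewrite -[LHS]mulr1 E mulKr.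
Qed.

(** * The induction hypothesis, and supports of products *)

Definition proper_trivial S := forall T, hopf_closed T -> T \subset S -> T != S ->
  braid_trivial T.

(** The functional [f] isolates the degree [h] part of the left factor, so [diagop (f \o b)] sends x
    y to a nonzero multiple of x (h y). This is the translate of x y by [h], as [h] fixes [x], and a
    diagonal operator cannot enlarge the support. *)
Lemma supp_shift x y h z : h \in gdeg x -> rho h x = x ->
  co z (b x * b y) != 0 -> co (rho h z) (b x * b y) != 0.
Proof.
rewrite inE => /neq0_co[x0 nz] hx zxy.
pose f v := co x0 (wcomp h (v * (b y)^-1)).
have flin : scalar f.
  by move=> c u v; rewrite /f mulrDl -scalerAl linearP co_lin.
have E : diagop (f \o b) (b x * b y) = f (b x * b y) *: pext (rho h) (b x * b y).
  rewrite ydaut_mul // !pext_b hx diagop_mul_r (bigD1 h) //= big1 ?addr0 => [|g gh].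
    rewrite pairingE // /f !mulrK //; congr (co x0 _ *: _).
    by rewrite (wcomp_homog h (wcomp_is_homog h (b x))) eqxx scale1r.
  rewrite pairingE // /f mulrK // (wcomp_homog h (wcomp_is_homog g (b x))) eq_sym (negPf gh).
  by rewrite scale0r co0 scale0r.
have := congr1 (co (rho h z)) E; rewrite co_diagop coZ pext_co /f mulrK // => F.
apply: contraNneq (mulf_neq0 nz zxy) => c0.
by rewrite -F c0 mulr0.
Qed.

(** The sum [N] over the stabilizer of [y] in [hT] takes the same value on all support points. It
    kills the terms x_g y of [diagop_mul_l] unless [g] is a degree of [y]; such a [g] fixes [y], so
    the remaining coefficients do not depend on [g]. Equal orbit sums then mean a common orbit. *)
Lemma supp_orbit x y z z' : (forall g, g \in gdeg y -> rho g y = y) ->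
  co z (b x * b y) != 0 -> co z' (b x * b y) != 0 ->
  exists2 h, tau h y = y & tau h z' = z.
Proof.
move=> dy zxy z'xy; pose Ga := [set h | tau h y == y].
pose N v := \sum_(h in Ga) pext (tau h) v.
have NE w : co w (b x * b y) != 0 -> N (b w) = N (b x * b y).
  move=> nz; apply: (scalerI nz).
  have sE g : N (wcomp g (b x) * b y) = (\sum_(h in Ga) beta g h) *: (wcomp g (b x) * b y).
    rewrite scaler_suml; apply: eq_bigr => h; rewrite inE => /eqP hy.
    by rewrite ydaut_mul // wcomp_is_homog pext_b hy -scalerAl.
  have s0 g : g \notin gdeg y -> \sum_(h in Ga) beta g h = 0.
    move=> /gdegP gy; have : exists2 h, h \in Ga & beta g h != 1.
      apply/exists_inP; apply: contra_notT gy => /exists_inPn H h hy.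
      by have := H h; rewrite inE hy eqxx negbK => /(_ isT)/eqP.
    move=> [h]; rewrite inE => /eqP hy bh.
    have : \sum_(k in Ga) beta g k = (\sum_(k in Ga) beta g k) * beta g h.
      rewrite mulr_suml (reindex_inj (mulIg h)) /=; apply: eq_big => [k|k _].
        by rewrite !inE tauM permM -{2}hy (inj_eq perm_inj).
      exact: betaMr.
    move/eqP; rewrite -subr_eq0 -{1}[\sum_(k in Ga) _]mulr1 -mulrBr mulf_eq0 subr_eq0.
    by rewrite [1 == _]eq_sym (negPf bh) orbF => /eqP.
  have NZ c u : N (c *: u) = c *: N u.
    by rewrite /N scaler_sumr; apply: eq_bigr => h _; rewrite linearZ.
  have NS (F : gT -> B) : N (\sum_g F g) = \sum_g N (F g).
    by rewrite /N exchange_big; apply: eq_bigr => h _; rewrite linear_sum.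
  rewrite -NZ -diagop_dirac diagop_mul_l NS.
  have exy : b x * b y = \sum_g wcomp g (b x) * b y by rewrite -mulr_suml wcomp_sum.
  rewrite [X in _ = _ *: N X]exy NS scaler_sumr.
  apply: eq_bigr => g _; rewrite NZ pairing_dirac; have [/dy-> //|gy] := boolP (g \in gdeg y).
  by rewrite sE s0 // scale0r !scaler0.
have := congr1 (co z) (etrans (NE z zxy) (esym (NE z' z'xy))); rewrite /N !coS.
have cnt w : \sum_(h in Ga) co z (pext (tau h) (b w)) = #|[set h in Ga | tau h w == z]|%:R.
  rewrite -sum1_card natr_sum [RHS]big_mkcond [LHS]big_mkcond; apply: eq_bigr => h _.
  by rewrite [in RHS]inE; case: ifP; rewrite //= pext_b co_b eq_sym; case: eqP.
rewrite !cnt => E.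
have : (#|[set h in Ga | tau h z' == z]|%:R : L) != 0.
  rewrite -E natL_eq0 cards_eq0; apply/set0Pn; exists 1%g.
  by rewrite !inE tau1 !perm1 !eqxx.
rewrite natL_eq0 cards_eq0 => /set0Pn[h]; rewrite !inE => /andP[/eqP hy /eqP hz].
by exists h.
Qed.

(** * Compatibility of points whose stabilizers do not fix everything *)

Lemma rhoX g n : rho (g ^+ n)%g = (rho g ^+ n)%g.
Proof. by elim: n => [|n IHn]; rewrite ?expg0 ?rho1 // !expgS rhoM IHn. Qed.

Lemma tauX h n : tau (h ^+ n)%g = (tau h ^+ n)%g.
Proof. by elim: n => [|n IHn]; rewrite ?expg0 ?tau1 // !expgS tauM IHn. Qed.

Lemma pext_fix s S : (forall z, z \in S -> s z = z) -> forall v, v \in gspan S -> pext s v = v.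
Proof.
move=> sS v vS; rewrite {1}(sum_gspan vS) [RHS](sum_gspan vS) linear_sum;
  apply: eq_bigr => z zS.
by rewrite linearZ /= pext_b sS.
Qed.

(** By contradiction: some [p]-element [h] is a degree of [x] and moves [y]. The fixed-point sets
    [Yx] and [Yy] are proper, hence trivially braided. A [p]-element [s] that agrees with [h] on [y]
    acts on a set of order prime to [p] as translation by (h y) y^-1, and a fixed point makes this
    translation trivial. *)
Lemma compatible_of_stab S x y : hopf_closed S -> coprime #|S| #|gT| -> proper_trivial S ->
  x \in S -> y \in S -> fixpts (gstab x) S != S -> fixpts (gstab y) S != S ->
  compatible x y.
Proof.
move=> cS coS IH xS yS nx ny g gx; apply/eqP; apply: contraT => gy.
have {g gx gy} [p [h [p_pr pG ph] [hx hy]]] := gdeg_p_elt gx gy.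
set Yx := fixpts (gstab x) S; set Yy := fixpts (gstab y) S.
have cYx : hopf_closed Yx by apply: closed_fixpts; rewrite ?stab_sub.
have cYy : hopf_closed Yy by apply: closed_fixpts; rewrite ?stab_sub.
have tYx : braid_trivial Yx by apply: IH; rewrite ?fixpts_sub.
have tYy : braid_trivial Yy by apply: IH; rewrite ?fixpts_sub.
have xYx : x \in Yx by apply: mem_fixpts_gstab.
have yYy : y \in Yy by apply: mem_fixpts_gstab.
have hxx : rho h x = x := tYx x x xYx xYx h hx.
have [z zxy] := neq0_co (mul_b_neq0 x (b_neq0 y)).
have hzxy := supp_shift hx hxx zxy.
have [k ky kz] := supp_orbit (tYy y y yYy yYy) zxy hzxy.
(* The [p]-constituent of [rho h * tau k], which fixes [z]. As [tau k] fixes [y], it moves [y]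
   exactly as [rho h] does. *)
pose s := (rho h * (tau k).`_p)%g.
have sA : s \in ydaut by rewrite ydautM ?constt_ydaut.
have ps : (p.-elt s)%g /\ s z = z.
  have -> : s = ((rho h * tau k).`_p)%g.
    rewrite consttM; last by apply/permP => w; rewrite !permM ydaut_tau.
    rewrite [((rho h).`_p)%g]constt_p_elt //.
    apply: pnat_dvd ph; rewrite order_dvdn; apply/eqP.
    by rewrite -rhoX expg_order rho1.
  split; first exact: p_elt_constt.
  by apply: constt_fix; rewrite permM.
case: ps => ps sz.
have sy : s y = rho h y.
  by rewrite permM ydaut_rho ?constt_ydaut // constt_fix.
pose u := b z * (b y)^-1.
(* By [diagop_mul_l], [b z] is a combination of products x_g y; dividing by [y] leaves components of
   [x]. *)
have uYx : u \in gspan Yx.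
  rewrite /u (b_diagop zxy) diagop_mul_l -scalerAl mulr_suml memvZ //; apply: memv_suml => g _.
  rewrite -scalerAl mulrK // memvZ // wcompE memvZ //; apply: memv_suml => l _.
  by rewrite memvZ // pext_b mem_gspan_b closed_tau.
have uU : u \is a GRing.unit by rewrite unitrMl ?unitrV.
have uy : b z = u * b y by rewrite mulrVK.
pose w := (pext s u)^-1 * u.
have wYx : w \in gspan Yx.
  rewrite gspan_mul ?gspan_inv ?pext_unit //; apply: pext_gspan => // v vYx.
  have [k' E] : exists k', ((tau k).`_p)%g = tau k' by eexists; rewrite /constt -tauX.
  by rewrite permM E closed_tau ?closed_rho.
(* Apply [s] to z = u y, where [z] is fixed. *)
have wy : b (rho h y) = w * b y.
  rewrite -mulrA -uy -{1}sz -(pext_b s z) uy ydaut_mul // mulKr ?pext_unit //.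
  by rewrite pext_b sy.
(* Thus w = (h y) y^-1 is also a quotient of two points of the trivially braided [Yy], hence a
   single point, and it lies in [Yx] as well. *)
have [w0 w0Yy wE] : exists2 w0, w0 \in Yy & w = b w0.
  have [y' y'Y yE] := trivial_inv cYy tYy yYy.
  have [w0 w0Y E] := trivial_mul cYy tYy (closed_rho cYy h yYy) y'Y.
  by exists w0; rewrite // -E -yE wy mulrK.
pose W := fixpts (gstab x :|: gstab y) S.
have cW : hopf_closed W by apply: closed_fixpts; rewrite // subUset !stab_sub.
have WE (v : X) : (v \in W) = (v \in Yx) && (v \in Yy).
  apply/fixptsP/andP => [[vS vE]|[/fixptsP[vS vx] /fixptsP[_ vy]]].
    by split; apply/fixptsP; split=> // t tE; apply: vE; rewrite inE tE ?orbT.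
  by split=> // t /setUP[/vx|/vy].
have w0W : w0 \in W by rewrite WE w0Yy -mem_gspan_b -wE wYx.
have tW (v v' : X) : v \in W -> v' \in W -> exists2 w, w \in W & b v * b v' = b w.
  move=> vW v'W; have [c cYy' E] : exists2 z, z \in Yy & b v * b v' = b z.
    by apply: trivial_mul => //; [move: vW | move: v'W]; rewrite WE => /andP[].
  by exists c; rewrite // -mem_gspan_b -E closed_mul.
(* [rho h] stabilizes [x] and [tau k] stabilizes [y], so both act trivially on [W]. *)
have sW (v : X) : v \in W -> s v = v.
  move=> /fixptsP[vS vE]; rewrite permM (vE (rho h)); last first.
    by apply/setUP; left; rewrite inE rho_aut hxx eqxx.
  by apply: constt_fix; apply: vE; apply/setUP; right; rewrite inE tau_aut ky eqxx.
(* The translate of [W] by [y]; on it [s] sends c y to c w y. *)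
pose T := [set v : X | [exists c in W, b v == b c * b y]].
have TP (v : X) : reflect (exists2 c, c \in W & b v = b c * b y) (v \in T).
  by rewrite inE; apply: (iffP exists_inP) => -[c cW' /eqP E]; exists c; rewrite ?E.
have sT (v : X) : v \in T -> s v \in T.
  move=> /TP[c cW' E]; have [c' c'W E'] := tW c w0 cW' w0W; apply/TP; exists c' => //.
  by rewrite -pext_b E ydaut_mul // !pext_b sW // sy wy wE mulrA E'.
have cardT : #|T| = #|W|.
  pose f (v : X) := odflt e0 [pick z | b z == b v * b y].
  have fE (v : X) : v \in W -> b (f v) = b v * b y.
    rewrite WE => /andP[_ vY]; rewrite /f; case: pickP => [c /eqP //|H].
    by have [c _ E] := trivial_mul cYy tYy vY yYy; have := H c; rewrite E eqxx.
  have finj : {in W &, injective f}.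
    by move=> v v' vW v'W /(congr1 b); rewrite !fE // => /(mulIr (b_unit y))/b_inj.
  rewrite -(card_in_imset finj); congr #|pred_of_set _|; apply/setP => v.
  apply/TP/imsetP => -[c cW' E]; exists c => //; first by apply: b_inj; rewrite fE.
  by rewrite E fE.
have pT : ~~ (p %| #|T|)%N.
  rewrite cardT; apply: contraL pG => pW; rewrite -prime_coprime //.
  apply: coprime_dvdl coS; apply: dvdn_trans pW _.
  by apply: dvdn_card_closed; rewrite ?fixpts_sub.
(* At a fixed point c w y = c y, so w = 1 and h y = y. *)
have [v /TP[c cW' E] sv] := perm_fix_exists ps sT pT.
have : b c * w * b y = b c * b y.
  by rewrite -mulrA -wy -E -[in RHS]sv -(pext_b s v) E ydaut_mul // !pext_b sW // sy.
move=> /(mulIr (b_unit y)); rewrite -{2}(mulr1 (b c)) => /(mulrI (b_unit c)) w1.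
by case/negP: hy; apply/eqP/b_inj; rewrite wy w1 mul1r.
Qed.

(** * Integrals and fixed points in cosets *)

Definition gcounit (v : B) : L := \sum_z co z v.

Lemma gcounitM u v : gcounit (u * v) = gcounit u * gcounit v.
Proof.
have epsS I (r : seq I) P (F : I -> B) :
  gcounit (\sum_(i <- r | P i) F i) = \sum_(i <- r | P i) gcounit (F i).
  by rewrite /gcounit exchange_big; apply: eq_bigr => z _; rewrite coS.
have epsZ c u' : gcounit (c *: u') = c * gcounit u'.
  by rewrite /gcounit mulr_sumr; apply: eq_bigr => z _; rewrite coZ.
rewrite {1}(co_sum u) mulr_suml epsS [gcounit u]/gcounit mulr_suml; apply: eq_bigr => x _.
rewrite -scalerAl epsZ; congr (_ * _).
rewrite {1}(co_sum v) mulr_sumr epsS; apply: eq_bigr => y _.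
by rewrite -scalerAr epsZ {1}/gcounit eps1 mulr1.
Qed.

Lemma gcounit_b x : gcounit (b x) = 1.
Proof. by have := eps1 x e0; rewrite b_e0 mulr1. Qed.

(** Left multiplication by a point of [S] permutes the summands of [gsum S], which is therefore an
    integral. *)
Lemma mul_ones S v : hopf_closed S -> braid_trivial S -> v \in gspan S ->
  v * gsum S = gcounit v *: gsum S.
Proof.
move=> cS tS vS.
have bE x : x \in S -> b x * gsum S = gsum S.
  move=> xS; pose f (y : X) := odflt e0 [pick z | b z == b x * b y].
  have fE (y : X) : y \in S -> b (f y) = b x * b y.
    move=> yS; rewrite /f; case: pickP => [z /eqP //|h].
    by have [z _ E] := trivial_mul cS tS xS yS; have := h z; rewrite E eqxx.
  have finj : {in S &, injective f}.
    by move=> y y' yS y'S /(congr1 b); rewrite !fE // => /(mulrI (b_unit x))/b_inj.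
  have fS : f @: S = S.
    apply/eqP; rewrite eqEcard card_in_imset // leqnn andbT;
      apply/subsetP => _ /imsetP[y yS ->].
    by rewrite -mem_gspan_b fE // closed_mul.
  rewrite /gsum -{2}fS big_imset //= mulr_sumr; apply: eq_bigr => y yS.
  by rewrite fE.
rewrite {1}(sum_gspan vS) mulr_suml.
under eq_bigr => x xS do rewrite -scalerAl bE //.
rewrite -scaler_suml; congr (_ *: _);
  rewrite /gcounit [RHS](bigID (mem S)) /= [X in _ + X]big1 ?addr0 //.
by move=> x xS; move/mem_gspanP: vS; apply.
Qed.

(** If [beta g] were trivial on the elements of [hT] preserving the coset of [x], nothing could
    cancel in the product assumed to vanish. A power of an element with nontrivial value is a
    [p]-element acting on a coset of order prime to [p]. *)
Lemma gcoset_fixed S T p x g : hopf_closed S -> hopf_closed T -> braid_trivial T ->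
  T \subset S -> x \in S ->
  prime p -> ~~ (p %| #|T|)%N -> (p.-elt g)%g -> wcomp g (b x) * gsum T = 0 ->
  exists h, beta g h != 1 /\ exists2 z, z \in gcoset x T & tau h z = z.
Proof.
move=> cS cT tT sTS xS p_pr pT pg xgT.
have [z0 nz0] : exists z0, co z0 (b x * gsum T) != 0.
  apply/neq0_co/mul_b_neq0; apply/eqP => /(congr1 (co e0))/eqP.
  rewrite co0 /gsum coS (bigD1 e0) ?closed1 //= co_b eqxx big1 ?addr0 ?true_neq0 //.
  by move=> y /andP[_ ye0]; rewrite co_b eq_sym (negPf ye0).
have onesK : gsum T \in gspan T by apply: memv_suml => y yT; rewrite mem_gspan_b.
have supp y z : co z (b y * gsum T) != 0 -> z \in gcoset y T.
  apply: contraNT => zy; have : b y * gsum T \in gspan (gcoset y T).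
    by rewrite gspan_gcoset //; apply/memv_imgP; exists (gsum T); rewrite // lfunE.
  by move/mem_gspanP/(_ z zy) => ->.
pose Om := [set h | tau h x \in gcoset x T].
have [h hO bh] : exists2 h, h \in Om & beta g h != 1.
  (* For [h] in [Om], [tau h x] is x v with [v] of counit 1, so [mul_ones] makes its product with
     [gsum T] equal to that of [x]. For other [h] the support lies in another coset and misses
     [z0]. *)
  apply/exists_inP; apply: contraT => /exists_inPn H.
  have := congr1 (co z0) xgT; rewrite co0 wcompE -scalerAl coZ mulr_suml coS.
  have -> : \sum_h co z0 ((beta g h)^-1 *: pext (tau h) (b x) * gsum T)
     = #|Om|%:R * co z0 (b x * gsum T).
    rewrite -sum1_card natr_sum mulr_suml [RHS]big_mkcond; apply: eq_bigr => h _.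
    rewrite -scalerAl coZ pext_b; case: ifP => hO.
      have := H h hO; rewrite negbK => /eqP->; rewrite invr1; congr (1 * co z0 _).
      have /mem_gcosetP[v vT E] : tau h x \in gcoset x T by rewrite inE in hO.
      rewrite E -mulrA (mul_ones cT tT vT); suff -> : gcounit v = 1 by rewrite scale1r.
      by have := congr1 gcounit E; rewrite gcounitM !gcounit_b mul1r.
    have [->|/supp z0h] := eqVneq (co z0 (b (tau h x) * gsum T)) 0; first by rewrite mulr0.
    have /negP[] := negbT hO; rewrite inE -(gcoset_eq cT (supp x z0 nz0)) (gcoset_eq cT z0h).
    exact: gcoset_refl.
  move/eqP; rewrite !mulf_eq0 invr_eq0 (negPf cardhT_neq0) (negPf nz0) orbF natL_eq0 cards_eq0.
  by move/eqP/setP/(_ 1%g); rewrite [1%g \in Om]inE tau1 perm1 gcoset_refl // inE.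
have stabC k n : tau k x \in gcoset x T -> forall z, z \in gcoset x T ->
  tau (k ^+ n)%g z \in gcoset x T.
  move=> kO z zx; elim: n => [|n IHn]; first by rewrite expg0 tau1 perm1.
  rewrite expgSr tauM permM -(gcoset_eq cT kO).
  by apply: pext_gcoset => //; apply: closed_tau.
(* With [m] the part of the order of [hT] prime to [p], [h ^+ m] has [p]-power order. The value
   [beta g h] is a root of unity of [p]-power order, so its [m]-th power is still not 1. *)
pose m := (#|hT|`_p^')%N; exists (h ^+ m)%g; split.
  apply: contra bh => /eqP bm.
  have bX n : beta g (h ^+ n)%g = beta g h ^+ n.
    by elim: n => [|n IHn]; rewrite ?expg0 ?beta1r // expgS exprS betaMr IHn.
  have bXl n : beta (g ^+ n)%g h = beta g h ^+ n.
    by elim: n => [|n IHn]; rewrite ?expg0 ?beta1l // expgS exprS betaMl IHn.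
  have : coprime m #[g]%g.
    by rewrite coprime_sym (pnat_coprime pg) // part_pnat.
  case: (posnP m) => [m0|m_gt0 cop]; first by have := part_gt0 p^' #|hT|; rewrite -/m m0.
  have [u v E _] := egcdnP #[g]%g m_gt0.
  rewrite (eqP cop) in E.
  have := congr1 (fun n => beta g h ^+ n) E; rewrite addn1 exprS [(u * m)%N]mulnC exprM -bX bm expr1n.
  by rewrite [(v * _)%N]mulnC exprM -bXl expg_order beta1l expr1n mulr1 => <-.
have pe : (p.-elt (tau (h ^+ m)))%g.
  apply: pnat_dvd (part_pnat p #|hT|); rewrite order_dvdn -tauX -expgM mulnC partnC ?tau1 //.
    by rewrite -cardsT expg_cardG ?inE // tau1.
  by apply/card_gt0P; exists 1%g.
have hx : tau h x \in gcoset x T by rewrite inE in hO.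
have [] := perm_fix_exists (T := gcoset x T) pe (stabC h m hx).
  by rewrite card_gcoset.
by move=> z zx hz; exists z.
Qed.

(** An incompatible pair yields a [p]-element [g] with a proper set [V] of fixed points. The points
    in [gen] are mutually compatible and include [V]; every point of [S] is z v with [z] in [gen]
    and [v] in the span of [V]. The degrees of such a product fix all of [gen], hence all of [S]. *)
Lemma trivial_step S : hopf_closed S -> coprime #|S| #|gT| -> proper_trivial S ->
  braid_trivial S.
Proof.
move=> cS coS IH x1 y1 x1S y1S g1 g1x1; apply/eqP; apply: contraT => g1y1.
have {g1 g1x1 g1y1} [p [g [p_pr pG pg] [gx1 gy1]]] := gdeg_p_elt g1x1 g1y1.
have g_neq1 : g != 1%g by apply: contraNneq gy1 => ->; rewrite rho1 perm1.
pose V := fixpts [set rho g] S.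
have cV : hopf_closed V by apply: closed_fixpts; rewrite ?sub1set.
have sVS : V \subset S := fixpts_sub _ _.
have tV : braid_trivial V.
  apply: IH => //; apply: contraNneq gy1 => VS.
  by move: y1S; rewrite -{1}VS => /fixptsP[_ ->]; rewrite ?inE.
pose gen z := z \in S /\ fixpts (gstab z) S != S.
have genC z z' : gen z -> gen z' -> compatible z z'.
  by move=> [zS nz] [z'S nz']; apply: compatible_of_stab nz nz'.
(* [rho g] stabilizes [c] but moves [y1]. *)
have genV (c : X) : c \in V -> gen c.
  move=> vV; split; first exact: (subsetP sVS).
  have /fixptsP[_ gc] := vV.
  apply: contraNneq gy1 => VS; move: y1S; rewrite -{1}VS => /fixptsP[_ h].
  by apply/eqP/h; rewrite inE rho_aut gc ?inE ?eqxx.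
(* The trace identity gives a point of the coset of [x] fixed by some [h] with [beta g h != 1]; this
   [h] moves [x1], because [g] is a degree of [x1]. *)
have genP x : x \in S -> exists z, gen z /\ exists2 v, v \in gspan V & b x = b z * v.
  move=> xS; have pV : ~~ (p %| #|V|)%N.
    apply: contraL pG => pV; rewrite -prime_coprime //; apply: coprime_dvdl coS.
    by apply: dvdn_trans pV (dvdn_card_closed cS cV sVS).
  have [h [bh [z zx hz]]] := gcoset_fixed cS cV tV sVS xS p_pr pV pg (wcomp_trace cS xS g_neq1).
  exists z; split; last first.
    by apply/mem_gcosetP; rewrite (gcoset_eq cV zx) gcoset_refl.
  split; first by apply: (subsetP (gcoset_sub cS sVS xS)).
  apply: contraNneq bh => VS; move: x1S; rewrite -{1}VS => /fixptsP[_ hx1].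
  by apply/eqP; move/gdegP: gx1; apply; apply: hx1; rewrite inE tau_aut hz eqxx.
suff tS : braid_trivial S by case/negP: gy1; apply/eqP/(tS x1 y1).
move=> x y xS yS g' g'x.
have [z [zG [v vV xE]]] := genP x xS.
have [z' [z'G [v' v'V yE]]] := genP y yS.
pose H k := forall c, gen c -> rho k c = c.
(* Otherwise every term in the homogeneous expansion of z v would have zero part in degree [g']. *)
have [k [l [kz lv E]]] : exists k l, [/\ k \in gdeg z, (exists2 c,
  c \in V & l \in gdeg c) & g' = (k * l)%g].
  have [[k l] /and3P[/= kz lv /eqP E]|none] :=
      pickP (fun q => [&& q.1 \in gdeg z, wcomp q.2 v != 0 & g' == (q.1 * q.2)%g]).
    exists k, l; split=> //; apply/exists_inP; apply: contraNT lv => /exists_inPn h.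
    apply/eqP; rewrite (sum_gspan vV) linear_sum big1 // => c cV'.
    by rewrite linearZ /= wcomp_out ?scaler0 ?h.
  have := g'x; rewrite inE xE -[b z]wcomp_sum -[v]wcomp_sum mulr_suml linear_sum big1 ?eqxx // => k _.
  rewrite mulr_sumr linear_sum big1 // => l _ /=.
  rewrite (wcomp_homog g' (homogM (wcomp_is_homog k _) (wcomp_is_homog l _))).
  have := none (k, l); rewrite /= inE; case: eqP => [->|_]; first by rewrite mul0r scaler0.
  case: eqP => [->|_]; first by rewrite mulr0 scaler0.
  by move=> /= ->; rewrite scale0r.
have Hk : H k by move=> c cG; apply: genC kz.
have Hl : H l by move=> c cG; have [c' c'V c'l] := lv; apply: genC c'l => //; apply: genV.
apply: b_inj; rewrite -pext_b yE ydaut_mul // pext_b E rhoM permM Hk // Hl //; congr (_ * _).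
by apply: (pext_fix _ v'V) => c cV'; rewrite permM Hk ?Hl //; apply: genV.
Qed.

(** Induction on the order of [S]; coprimality passes to closed subsets by divisibility. *)
Lemma closed_trivial S : hopf_closed S -> coprime #|S| #|gT| -> braid_trivial S.
Proof.
have [n] := ubnP #|S|; elim: n S => // n IHn S; rewrite ltnS => Sn cS coS.
apply: trivial_step => // T cT sTS nTS; apply: IHn => //.
  apply: leq_trans Sn; apply: proper_card; rewrite properEneq nTS //.
exact: coprime_dvdl (dvdn_card_closed cS cT sTS) coS.
Qed.

Theorem all_compatible : coprime #|X| #|gT| -> forall x y, compatible x y.
Proof.
move=> coX x y; apply: (closed_trivial (S := [set: X])); rewrite ?inE ?cardsT //.
by split=> // *; rewrite ?inE //; apply/mem_gspanP => z; rewrite inE.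
Qed.

End Braided.
End Grouplikes.

(** * Characters of a commutative semisimple algebra *)

(** For a simple ideal I, the ideal a I is 0 or I; in the second case a I = a (a I) = 0 as well. So
    [a] annihilates every summand, hence 1. *)
Lemma semisimple_reduced (K : fieldType) (A : falgType K) :
  (forall a b : A, a * b = b * a) -> semisimple_alg A -> forall a : A, a * a = 0 -> a = 0.
Proof.
move=> commA [n [I [simpI _ sumI]]] a aa0.
have aI i c : c \in I i -> a * c = 0.
  move=> cI; have [lI nzI minI] := simpI i.
  pose J := (amull a @: I i)%VS.
  have aJ x : x \in J -> a * x = 0.
    by case/memv_imgP => y yI ->; rewrite lfunE /= mulrA aa0 mul0r.
  have JI : (J <= I i)%VS.
    by apply/subvP => _ /memv_imgP[y yI ->]; rewrite lfunE; apply: lI.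
  have lJ : left_ideal J.
    move=> u _ /memv_imgP[y yI ->]; apply/memv_imgP; exists (u * y); first exact: lI.
    by rewrite !lfunE /= mulrA (commA u) mulrA.
  have aIJ : a * c \in J by apply/memv_imgP; exists c; rewrite ?lfunE.
  have [J0|JE] := minI J lJ JI; first by move: aIJ; rewrite J0 memv0 => /eqP.
  by apply: aJ; rewrite JE.
have : 1 \in (\sum_i I i)%VS by rewrite sumI memvf.
case/memv_sumP => u uI E; rewrite -[a]mulr1 E mulr_sumr big1 // => i _.
exact/aI/uI.
Qed.

(** * The regular representation and its simultaneous diagonalization *)

Section Regular.
Variables (K : fieldType) (A : falgType K) (n : nat) (e : n.+1.-tuple A).
Hypothesis commA : forall a b : A, a * b = b * a.
Hypothesis eP : basis_of fullv e.

Definition regmx (a : A) : 'M[K]_n.+1 := \matrix_(k, j) coord e k (e`_j * a).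

Lemma regmx_linear : linear regmx.
Proof.
by move=> c a d; apply/matrixP => k j; rewrite !mxE mulrDr -scalerAr linearP.
Qed.
HB.instance Definition _ := GRing.isLinear.Build K A 'M[K]_n.+1 _ regmx regmx_linear.

Lemma coordE a : a = \sum_k coord e k a *: e`_k.
Proof. by apply: coord_basis eP _; rewrite memvf. Qed.

Lemma regmxM a c : regmx (a * c) = regmx c *m regmx a.
Proof.
apply/matrixP => k j; rewrite !mxE mulrA {1}(coordE (e`_j * a)) mulr_suml linear_sum.
by apply: eq_bigr => l _; rewrite -scalerAl linearZ !mxE /= mulrC.
Qed.

Lemma regmx1 : regmx 1 = 1%:M.
Proof.
by apply/matrixP => k j; rewrite !mxE mulr1 coord_free ?(basis_free eP) // eq_sym.
Qed.

Lemma regmx_inj a : regmx a = 0 -> a = 0.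
Proof.
move=> a0; rewrite -[a]mul1r {1}(coordE 1) mulr_suml big1 // => j _.
rewrite -scalerAl (coordE (e`_j * a)) big1 ?scaler0 // => k _.
by have /matrixP/(_ k j) := a0; rewrite !mxE => ->; rewrite scale0r.
Qed.

Lemma regmx_horner a p : horner_mx (regmx a) p = regmx (horner_alg a p).
Proof.
elim/poly_ind: p => [|p c IH]; first by rewrite !rmorph0 linear0.
rewrite !rmorphD !rmorphM /= horner_mx_X horner_mx_C horner_algX horner_algC linearD /=.
rewrite IH linearZ /= (regmx1 : regmx (GRing.one A) = _) scalemx1; congr (_ + _).
by rewrite commA regmxM.
Qed.

Hypothesis charK0 : [pchar K] =i pred0.
Hypothesis redA : forall a : A, a * a = 0 -> a = 0.

(** The minimal polynomial p of multiplication by [a] is squarefree: if p = t g^2, then t g takes a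
    value of square 0 at [a], so p divides t g and g is constant. In characteristic zero this gives
    separability. *)
Lemma separable_annihilator a : exists2 q : {poly K}, separable_poly q & horner_alg (a :
  A) q = 0.
Proof.
pose p := mxminpoly (regmx a).
have pa0 : horner_alg a p = 0 by apply: regmx_inj; rewrite -regmx_horner mx_root_minpoly.
exists p => //.
have p0 : p != 0 by rewrite monic_neq0 // mxminpoly_monic.
have sqf u v : u * v %| p -> coprimep u v.
  move=> uvp; set g := gcdp u v; have ggp : g * g %| p.
    by apply: dvdp_trans uvp; apply: dvdp_mul; rewrite ?dvdp_gcdl ?dvdp_gcdr.
  have [t pE] : exists t, p = t * (g * g) by apply/dvdpP.
  have g0 : g != 0 by apply: contraNneq p0 => g0; rewrite pE g0 !mulr0.
  have tg0 : t * g != 0 by apply: contraNneq p0 => tg0; rewrite pE mulrA tg0 mul0r.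
  have : p %| t * g.
    apply: mxminpoly_min; rewrite regmx_horner.
    rewrite (_ : horner_alg a (t * g) = 0) ?linear0 //; apply: redA.
    have : horner_alg a (p * t) = 0.
      by rewrite rmorphM /= pa0 mul0r.
    rewrite -rmorphM => <-; congr (horner_alg a _); by rewrite pE mulrACA [RHS]mulrAC.
  move=> /(dvdp_leq tg0); rewrite pE mulrA size_mul // => le; apply: contraLR le.
  rewrite /coprimep -ltnNge -/g => g1; have : (1 < size g)%N.
    by rewrite ltn_neqAle eq_sym g1 size_poly_gt0.
  case: (size g) => [|[|k]] // _; rewrite addnS /= addnS ltnS leq_addr //.
apply/separable_polyP; split=> // u up u1; apply/eqP => du0.
have /polyP/(_ (size u).-2) := du0; rewrite coef_deriv coef0.
have -> : (size u).-2.+1 = (size u).-1 by case: (size u) u1 => [|[]].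
rewrite -mulr_natr => /eqP; rewrite mulf_eq0 -/(lead_coef u) lead_coef_eq0.
move/pcharf0P: charK0 => ->; case/orP => [/eqP u0|].
  by rewrite u0 size_poly0 in u1.
by case: (size u) u1 => [|[]].
Qed.

Definition alg_hom (L : fieldExtType K) (f : 'Hom(A, L)) :=
  (forall a c, f (a * c) = f a * f c) /\ f 1 = 1.

(** The multiplication matrices commute and each is annihilated by a split separable polynomial, so
    they are diagonalized together. A common left eigenvector, read as a functional and normalized
    at 1, is an algebra homomorphism. *)
Lemma alg_homs_exist (L : fieldExtType K) (zs : seq L) :
  (forall j : 'I_n.+1, exists q : {poly K}, [/\ separable_poly q, horner_alg (e`_j : A) q = 0
     & map_poly (in_alg L) q %| \prod_(z <- zs) ('X - z%:P)]) ->
  exists chi : 'I_n.+1 -> 'Hom(A, L), (forall i, alg_hom (chi i)) /\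
    (\matrix_(i, j) chi i e`_j \in unitmx).
Proof.
move=> split_zs; pose iota : {rmorphism K -> L} := in_alg L.
pose M a : 'M[L]_n.+1 := map_mx iota (regmx a).
pose ev (f : 'rV[L]_n.+1) a : L := \sum_k coord e k a *: f 0 k.
have evZ f c a : ev f (c *: a) = c *: ev f a.
  by rewrite /ev scaler_sumr; apply: eq_bigr => k _; rewrite linearZ scalerA.
have evS f (F : 'I_n.+1 -> A) : ev f (\sum_j F j) = \sum_j ev f (F j).
  rewrite /ev exchange_big; apply: eq_bigr => k _.
  by rewrite linear_sum scaler_suml.
have evb f (j : 'I_n.+1) : ev f e`_j = f 0 j.
  rewrite /ev (bigD1 j) //= coord_free ?(basis_free eP) // eqxx scale1r big1 ?addr0 // => k kj.
  by rewrite coord_free ?(basis_free eP) // eq_sym (negPf kj) scale0r.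
have evM f c a : ev (f *m M a) c = ev f (c * a).
  rewrite [c]coordE mulr_suml !evS; apply: eq_bigr => j _.
  rewrite -scalerAl !evZ evb !mxE; congr (_ *: _).
  apply: eq_bigr => k _; rewrite !mxE /iota /= -[RHS]mulr_algl mulrC.
  by [].
have Mdiag (j : 'I_n.+1) : diagonalizable (M e`_j).
  apply/diagonalizableP; have [q [sepq qe qdvd]] := split_zs j.
  have [m Dm] := dvdp_prod_XsubC qdvd; exists (mask m zs).
    by rewrite -separable_prod_XsubC -(eqp_separable Dm) separable_map.
  rewrite -(eqp_dvdr _ Dm); apply: mxminpoly_min.
  by rewrite /M -map_horner_mx regmx_horner qe linear0 map_mx0.
have [P Punit /allP Pdiag] : codiagonalizable [seq M a | a <- e].
  apply/codiagonalizableP; split.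
    move=> _ _ /mapP[a _ ->] /mapP[c _ ->]; rewrite /comm_mx -!map_mxM.
    by rewrite -!regmxM commA.
  move=> C /(nthP 0)[j]; rewrite size_map size_tuple => jn <-;
    rewrite (nth_map 0) ?size_tuple //; apply: (Mdiag (Ordinal jn)).
have eigP (j : 'I_n.+1) : exists D : 'rV[L]_n.+1, P *m M e`_j = diag_mx D *m P.
  have /Pdiag/diagonalizable_forPex[D /(simmxP Punit) E] : M e`_j \in [seq M a | a <- e].
    by apply: map_f; rewrite mem_nth ?size_tuple.
  by exists D.
have [D DE] : exists D : 'I_n.+1 -> 'rV[L]_n.+1, forall j :
  'I_n.+1, P *m M e`_j = diag_mx (D j) *m P.
  apply: (fin_all_exists eigP).
pose f i := row i P; pose lam i a := \sum_j coord e j a *: D j 0 i.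
have f_lam i c a : ev (f i) (c * a) = lam i a * ev (f i) c.
  rewrite {1}[a]coordE mulr_sumr evS mulr_suml; apply: eq_bigr => j _.
  rewrite -scalerAr evZ -scalerAl -evM; congr (_ *: _).
  rewrite /f -row_mul DE mul_diag_mx /ev mulr_sumr; apply: eq_bigr => k _.
  by rewrite !mxE -scalerAr.
(* An eigenfunctional that vanishes at 1 vanishes everywhere, but the rows of [P] are nonzero. *)
have f1 i : ev (f i) 1 != 0.
  apply/eqP => f10; have fi0 : f i = 0.
    by apply/rowP => j; rewrite -evb -[e`_j]mul1r f_lam f10 mulr0 mxE.
  have := Punit; rewrite unitmxE -(mul1mx P).
  have : (delta_mx 0 i : 'rV[L]_n.+1) *m P = 0 by rewrite -rowE.
  move=> /(congr1 (mulmx^~ (invmx P))); rewrite mulmxK // mul0mx => /matrixP/(_ 0 i)/eqP.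
  by rewrite !mxE !eqxx oner_eq0.
have chi_lin i : linear (fun a => ev (f i) a / ev (f i) 1).
  move=> c a d; rewrite /ev scalerAl -mulrDl; congr (_ / _).
  rewrite scaler_sumr -big_split; apply: eq_bigr => k _.
  by rewrite linearP scalerDl scalerA.
pose chi i : 'Hom(A, L) := linfun (HB.pack (fun a => ev (f i) a / ev (f i) 1)
   (GRing.isLinear.Build K A L _ _ (chi_lin i)) : {linear A -> L}).
have chiE i a : chi i a = ev (f i) a / ev (f i) 1 by rewrite lfunE.
exists chi; split=> [i|].
  split=> [a c|]; rewrite !chiE ?divff //.
  have Ec : ev (f i) c = lam i c * ev (f i) 1 by rewrite -f_lam mul1r.
  by rewrite f_lam Ec mulfK // -mulrA mulrC.
have -> : \matrix_(i, j) chi i e`_j = diag_mx (\row_i (ev (f i) 1)^-1) *m P.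
  by apply/matrixP => i j; rewrite mxE chiE evb mul_diag_mx !mxE mulrC.
rewrite unitmx_mul Punit andbT unitmxE det_diag unitfE.
by apply/prodf_neq0 => i _; rewrite mxE invr_eq0.
Qed.

End Regular.

(** * The dual of a Yetter-Drinfel'd Hopf algebra *)

(** Transparent, so that product and unit of the result unfold to [mul] and [one]. *)
Definition falg_of (L : fieldType) (V : vectType L) (mul : V -> V -> V) (one : V)
  (mulA : associative mul) (mul1 : left_id one mul) (mulr1 : right_id one mul)
  (mulDl : left_distributive mul +%R) (mulDr : right_distributive mul +%R)
  (one_neq0 : one != 0)
  (mulZl : forall c x y, c *: mul x y = mul (c *: x) y)
  (mulZr : forall c x y, c *: mul x y = mul x (c *: y)) : falgType L.
Proof.
pose mulM := GRing.Zmodule_isNzRing.Build V mulA mul1 mulr1 mulDl mulDr one_neq0.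
pose rV : nzRingType := HB.pack V mulM.
pose lM : GRing.Lmodule_isLalgebra L rV := GRing.Lmodule_isLalgebra.Build L rV mulZl.
pose lV : lalgType L := HB.pack rV lM.
pose aM : GRing.Lalgebra_isAlgebra L lV := GRing.Lalgebra_isAlgebra.Build L lV mulZr.
pose aV : algType L := HB.pack lV aM.
pose uM := Algebra_isFalgebra.Build L aV.
exact: (HB.pack V aV uM : falgType L).
Defined.

(** * Linear identities on tensor products *)

Lemma tens_ind (K : fieldType) (U V : vectType K) (P : tens U V -> Prop) :
  P 0 -> (forall c s t, P s -> P t -> P (c *: s + t)) -> (forall u v, P (u \ot v)) ->
    forall t, P t.
Proof.
move=> P0 PD Pp t.
suff -> : t = \sum_i \sum_j t i j *: ((vbasis {:U})`_i \ot (vbasis {:V})`_j).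
  have PA s s' : P s -> P s' -> P (s + s') by move=> Ps Ps'; rewrite -[s]scale1r; apply: PD.
  apply: big_ind => // i _; apply: big_ind => // j _.
  by rewrite -[_ *: _]addr0; apply: PD.
pose f : 'Hom(tens U V, tens U V) :=
  tlift (fun u v => u \ot v).
have tE : t = f t.
  rewrite -[LHS]id_lfunE; congr (fun_of_lfun _ t); apply: tens_ext => u v.
  by rewrite id_lfunE /f tliftE //; apply: pure_tens_bilin.
by rewrite {1}tE /f lfunE.
Qed.

Lemma tens_eq (K : fieldType) (U V W : vectType K) (F G : tens U V -> W) :
  linear F -> linear G -> (forall u v, F (u \ot v) = G (u \ot v)) -> F =1 G.
Proof.
move=> Fl Gl FG; apply: tens_ind => //.
  have := Fl (-1) 0 0; have := Gl (-1) 0 0; rewrite !scaleN1r !addNr.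
  by move=> -> ->.
by move=> c s t FGs FGt; rewrite Fl Gl FGs FGt.
Qed.

Lemma pure_tensZl (K : fieldType) (U V : vectType K) c (u : U) (v : V) :
  (c *: u) \ot v = c *: (u \ot v).
Proof. by apply/matrixP => i j; rewrite !mxE linearZ /= mulrA. Qed.

Lemma pure_tensZr (K : fieldType) (U V : vectType K) c (u : U) (v : V) :
  u \ot (c *: v) = c *: (u \ot v).
Proof. by apply/matrixP => i j; rewrite !mxE linearZ /= mulrCA. Qed.

Lemma pure_tens_suml (K : fieldType) (U V : vectType K) I (r : seq I) P (F : I -> U) (v : V) :
  (\sum_(i <- r | P i) F i) \ot v = \sum_(i <- r | P i) (F i \ot v).
Proof.
apply/matrixP => i j; rewrite summxE !mxE linear_sum mulr_suml.
by apply: eq_bigr => k _; rewrite mxE.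
Qed.

Lemma pure_tens_sumr (K : fieldType) (U V : vectType K) I (r : seq I) P (u : U) (F : I -> V) :
  u \ot (\sum_(i <- r | P i) F i) = \sum_(i <- r | P i) (u \ot F i).
Proof.
apply/matrixP => i j; rewrite summxE !mxE linear_sum mulr_sumr.
by apply: eq_bigr => k _; rewrite mxE.
Qed.

(** * Products of functionals with values in an extension field *)

Section TensorFunctional.
Variables (K : fieldType) (L : fieldExtType K).
Implicit Types U V W : vectType K.

Definition tfun U V (h : 'Hom(U, L)) (h' : 'Hom(V, L)) : 'Hom(tens U V, L) :=
  tlift (fun u v => h u * h' v).

Lemma tfunE U V (h : 'Hom(U, L)) (h' : 'Hom(V, L)) u v : tfun h h' (u \ot v) = h u * h' v.
Proof.
apply: tliftE; split=> [w|w] c x y; rewrite linearP.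
  by rewrite mulrDl -scalerAl.
by rewrite mulrDr -scalerAr.
Qed.

Lemma tfun_tmap U V U' V' (h : 'Hom(U', L)) (h' : 'Hom(V', L)) (f : 'Hom(U, U')) (g :
  'Hom(V, V')) t :
  tfun h h' (tmap f g t) = tfun (h \o f) (h' \o g) t.
Proof.
apply: (tens_eq (F := fun t => tfun h h' (tmap f g t))) t => [c s t|c s t|u v].
- by rewrite !linearP.
- by rewrite !linearP.
by rewrite tmapE !tfunE !comp_lfunE.
Qed.

Lemma tfun_tassoc U V W (h1 : 'Hom(U, L)) (h2 : 'Hom(V, L)) (h3 : 'Hom(W, L)) t :
  tfun (tfun h1 h2) h3 t = tfun h1 (tfun h2 h3) (tassoc U V W t).
Proof.
apply: (tens_eq (F := fun t => tfun (tfun h1 h2) h3 t)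
  (G := fun t => tfun h1 (tfun h2 h3) (tassoc U V W t))) t => [c s t|c s t|s w].
- by rewrite !linearP.
- by rewrite !linearP.
have [pl _] := @pure_tens_bilin K (tens U V) W.
apply: (tens_eq (F := fun s => tfun (tfun h1 h2) h3 (s \ot w))
  (G := fun s => tfun h1 (tfun h2 h3) (tassoc U V W (s \ot w)))) s => [c s t|c s t|u v].
- by rewrite pl linearP.
- by rewrite pl !linearP.
by rewrite tassocE !tfunE mulrA.
Qed.

Lemma tfun_suml (I : finType) U V (h : 'Hom(U, L)) (hi : I -> 'Hom(U, L)) (c : I -> L) (h' :
  'Hom(V, L)) t :
  (forall u, h u = \sum_i c i * hi i u) -> tfun h h' t = \sum_i c i * tfun (hi i) h' t.
Proof.
move=> hE; apply: (tens_eq (F := fun t => tfun h h' t)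
  (G := fun t => \sum_i c i * tfun (hi i) h' t)) t => [k s t|k s t|u v].
- by rewrite linearP.
- rewrite scaler_sumr -big_split; apply: eq_bigr => i _.
  by rewrite linearP mulrDr scalerAr.
rewrite tfunE hE mulr_suml; apply: eq_bigr => i _.
by rewrite tfunE mulrA.
Qed.

Lemma tfun_sumr (I : finType) U V (h : 'Hom(U, L)) (hi : I -> 'Hom(V, L)) (c : I -> L) (h' :
  'Hom(V, L)) t :
  (forall u, h' u = \sum_i c i * hi i u) -> tfun h h' t = \sum_i c i * tfun h (hi i) t.
Proof.
move=> hE; apply: (tens_eq (F := fun t => tfun h h' t)
  (G := fun t => \sum_i c i * tfun h (hi i) t)) t => [k s t|k s t|u v].
- by rewrite linearP.
- rewrite scaler_sumr -big_split; apply: eq_bigr => i _.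
  by rewrite linearP mulrDr scalerAr.
rewrite tfunE hE mulr_sumr; apply: eq_bigr => i _.
by rewrite tfunE mulrCA.
Qed.

End TensorFunctional.

(** * The grading defined by a coaction of the group ring *)

Section Components.
Variables (K : fieldType) (gT : finGroupType).
Local Notation H := (grpalg K gT).
Implicit Types (V : vectType K) (g k m : gT).

Definition cpt V (g : gT) : 'Hom(tens H V, V) := tlift (fun (h : H) v => (h g : K) *: v).

Lemma cptE V g (h : H) (v : V) : cpt V g (h \ot v) = (h g : K) *: v.
Proof.
apply: tliftE; split=> [w|w] c x y; last by rewrite linearP.
by rewrite !ffunE scalerDl; congr (_ + _); apply/esym/scalerA.
Qed.

Lemma cpt_gelt V g k (v : V) : cpt V g (gelt K k \ot v) = (g == k)%:R *: v.
Proof. by rewrite cptE ffunE. Qed.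

Lemma cpt_sum V (t : tens H V) : t = \sum_g (gelt K g \ot cpt V g t).
Proof.
have [pl pr] := @pure_tens_bilin K H V.
apply: (tens_eq (F := fun t => t) (G :=
  fun t => \sum_g (gelt K g \ot cpt V g t))) t => [//|c s t|h v].
  rewrite scaler_sumr -big_split; apply: eq_bigr => g _.
  by rewrite linearP pr.
rewrite {1}[h]grpalgE pure_tens_suml; apply: eq_bigr => g _; rewrite cptE.
by rewrite pure_tensZl pure_tensZr.
Qed.

Lemma cpt_tmap V V' (f : 'Hom(V, V')) g t : cpt V' g (tmap \1%VF f t) = f (cpt V g t).
Proof.
apply: (tens_eq (F := fun t => cpt V' g (tmap \1%VF f t))
  (G := fun t => f (cpt V g t))) t => [c s t|c s t|h v]; rewrite ?linearP //.
by rewrite tmapE !cptE id_lfunE linearZ.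
Qed.

Section Module.
Variables (V : vectType K) (X : yd_data gT V).
Hypothesis modX : is_ydmodule X.

Definition gact g : 'End(V) := yd_act X (gelt K g).
Definition hcomp g : 'End(V) := (cpt V g \o yd_coact X)%VF.

Lemma hcompE g v : hcomp g v = cpt V g (yd_coact X v).
Proof. exact: comp_lfunE. Qed.

Lemma coact_hcomp v : yd_coact X v = \sum_g (gelt K g \ot hcomp g v).
Proof. by rewrite {1}[yd_coact X v]cpt_sum; apply: eq_bigr => g _; rewrite hcompE. Qed.

Lemma gact1 v : gact 1%g v = v.
Proof. by rewrite /gact -[gelt K 1]/(1 : H) (ydm_act1 modX) id_lfunE. Qed.

Lemma gactM g k v : gact (g * k)%g v = gact g (gact k v).
Proof. by rewrite /gact -geltM (ydm_actM modX) comp_lfunE. Qed.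

(** Coassociativity, read at the group elements [k] and [g] of the two left factors. *)
Lemma hcomp_hcomp g k v : hcomp g (hcomp k v) = (g == k)%:R *: hcomp k v.
Proof.
have E t : cpt V g (cpt _ k (tassoc H H V (tmap (grpalg_comul K gT) \1%VF t)))
    = (g == k)%:R *: cpt V k t.
  rewrite {1}[t]cpt_sum !linear_sum (bigD1 k) //= tmapE grpalg_comul_gelt id_lfunE tassocE.
  rewrite !cpt_gelt eqxx scale1r cpt_gelt big1 ?addr0 // => m mk.
  by rewrite tmapE grpalg_comul_gelt tassocE cpt_gelt eq_sym (negPf mk) scale0r linear0.
by rewrite !hcompE -E (ydm_coassoc modX) cpt_tmap.
Qed.

Lemma hcomp_sum v : \sum_g hcomp g v = v.
Proof.
rewrite -[RHS](ydm_counit modX) coact_hcomp linear_sum; apply: eq_bigr => g _.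
rewrite /= tliftE ?grpalg_counit_gelt ?scale1r //; split=> [w|w] c x y /=.
  by rewrite linearP scalerDl; congr (_ + _); apply/esym/scalerA.
by rewrite linearP.
Qed.

Lemma hcomp_gact g k v : hcomp g (gact k v) = gact k (hcomp g v).
Proof. by rewrite !hcompE (ydm_compat modX) cpt_tmap. Qed.

End Module.

Lemma hcomp_hom (V W : vectType K) (X : yd_data gT V) (Y : yd_data gT W) (f : 'Hom(V, W)) g v :
  yd_hom X Y f -> hcomp Y g (f v) = f (hcomp X g v).
Proof. by move=> fP; rewrite !hcompE (yd_hom_coact fP) cpt_tmap. Qed.

Lemma hcomp_tens (V W : vectType K) (X : yd_data gT V) (Y : yd_data gT W) m v w :
  hcomp (yd_tens X Y) m (v \ot w) =
  \sum_g \sum_k (m == (g * k)%g)%:R *: (hcomp X g v \ot hcomp Y k w).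
Proof.
have [pl pr] := @pure_tens_bilin K V W.
have [ql qr] := @pure_tens_bilin K H (tens V W).
have bil1 (h : H) (v' : V) : bilin (fun (k : H) (w' : W) => (h * k) \ot v' \ot w').
  by split=> [x|x] c y z /=; [rewrite mulrDr -scalerAr ql | rewrite pr qr].
have bil2 : bilin (fun (h : H) (v' : V) =>
    tlift (fun (k : H) (w' : W) => (h * k) \ot v' \ot w') (yd_coact Y w)).
  split=> [x|x] c y z; apply: tlift_linearP => h w'.
    by rewrite mulrDl -scalerAl ql.
  by rewrite pl qr.
rewrite hcompE yd_coact_tensE (coact_hcomp X) !linear_sum; apply: eq_bigr => g _.
rewrite /= tliftE // (coact_hcomp Y) !linear_sum; apply: eq_bigr => k _.
by rewrite /= tliftE // geltM cpt_gelt.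
Qed.

(** In this form the quasisymmetry is the flip as soon as [g] fixes [w] whenever [v] has a nonzero
    component of degree [g]. *)
Lemma quasisym_hcomp (V W : vectType K) (X : yd_data gT V) (Y : yd_data gT W) v w :
  quasisym X Y (v \ot w) = \sum_g (gact Y g w \ot hcomp X g v).
Proof.
have [pl pr] := @pure_tens_bilin K W V.
rewrite quasisymE coact_hcomp linear_sum; apply: eq_bigr => g _.
rewrite /= tliftE //; by split=> [x|x] c y z /=;
  [rewrite linearP add_lfunE scale_lfunE pl | rewrite pr].
Qed.

End Components.

Lemma alg_unitE (K : fieldType) (A : falgType K) c : alg_unit A c = (c : K)%:A.
Proof.
have lin : linear (fun c : K^o => (c : K)%:A : A).
  by move=> k x y; rewrite scalerDl; congr (_ + _); apply/esym/scalerA.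
pose f : {linear K^o -> A} := HB.pack (fun c : K^o => (c : K)%:A : A)
  (GRing.isLinear.Build K K^o A *:%R (fun c : K^o => (c : K)%:A : A) lin).
exact: (lfunE f).
Qed.

Lemma yd_triv_actE (K : fieldType) (gT : finGroupType) g c :
  yd_act (yd_triv K gT) (gelt K g) c = c.
Proof.
pose F (h : grpalg K gT) : 'End(K^o) := grpalg_counit K gT h *: (\1%VF : 'End(K^o)).
have lin : linear F.
  by move=> k x y; rewrite /F linearP scalerDl; congr (_ + _); apply/esym/scalerA.
pose f : {linear grpalg K gT -> 'End(K^o)} := HB.pack F (GRing.isLinear.Build K _ _ *:%R F lin).
rewrite -[yd_act _]/(linfun f) lfunE /= /F grpalg_counit_gelt.
by rewrite scale1r id_lfunE.
Qed.

Lemma yd_triv_coactE (K : fieldType) (gT : finGroupType) c :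
  yd_coact (yd_triv K gT) c = gelt K (1%g : gT) \ot c.
Proof.
have [_ pr] := @pure_tens_bilin K (grpalg K gT) K^o.
pose f : {linear K^o -> tens (grpalg K gT) K^o} :=
  HB.pack (fun c : K^o => gelt K (1%g : gT) \ot c) (GRing.isLinear.Build K _ _ *:%R _ (pr
    (gelt K (1%g : gT)))).
exact: (lfunE f).
Qed.

(** * Convolution of functionals on a Yetter-Drinfel'd Hopf algebra *)

Section Hopf.
Variables (K : fieldType) (gT : finGroupType) (A : falgType K) (X : yd_data gT A).
Variables (Delta : 'Hom(A, tens A A)) (eps : 'Hom(A, K^o)).
Hypothesis hopfA : is_yd_hopf X Delta eps.
Local Notation pi := (hcomp X).
Local Notation act := (gact X).
Let modX := ydh_module hopfA.

Lemma gact_mul g a c : act g (a * c) = act g a * act g c.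
Proof.
have := yd_hom_act (ydh_mul hopfA) (gelt K g) (a \ot c).
by rewrite yd_act_tensE !alg_mulE.
Qed.

Lemma gact_1 g : act g 1 = 1.
Proof.
have := yd_hom_act (ydh_unit hopfA) (gelt K g) 1; rewrite !alg_unitE scale1r => <-.
by rewrite yd_triv_actE scale1r.
Qed.

Lemma hcomp_mul m a c : pi m (a * c) = \sum_g \sum_k (m == (g * k)%g)%:R *: (pi g a * pi k c).
Proof.
rewrite -alg_mulE (hcomp_hom _ _ (ydh_mul hopfA)) hcomp_tens linear_sum.
apply: eq_bigr => g _; rewrite linear_sum; apply: eq_bigr => k _.
by rewrite linearZ /= alg_mulE.
Qed.

Lemma hcomp_1 m : pi m 1 = (m == 1%g)%:R.
Proof.
have E : alg_unit A 1 = 1 by rewrite alg_unitE scale1r.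
rewrite -{1}E (hcomp_hom _ _ (ydh_unit hopfA)) hcompE yd_triv_coactE.
by rewrite cpt_gelt linearZ /= E scaler_nat.
Qed.

Variable (L : fieldExtType K).
Implicit Types h : 'Hom(A, L).

Definition conv h h' : 'Hom(A, L) := (tfun h h' \o Delta)%VF.

Lemma convE h h' a : conv h h' a = tfun h h' (Delta a). Proof. exact: comp_lfunE. Qed.

Lemma convA h1 h2 h3 : conv h1 (conv h2 h3) = conv (conv h1 h2) h3.
Proof.
apply/lfunP => a; rewrite !convE /conv -[h1 in LHS]comp_lfun1r -[h3 in RHS]comp_lfun1r.
by rewrite -!tfun_tmap tfun_tassoc (ydh_coassoc hopfA).
Qed.

Definition epsL : 'Hom(A, L) := (alg_unit L \o eps)%VF.

Lemma epsLE a : epsL a = (eps a : K)%:A.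
Proof. by rewrite comp_lfunE alg_unitE. Qed.

Lemma conv1l h : conv epsL h = h.
Proof.
apply/lfunP => a; rewrite convE -[in RHS](ydh_counitl hopfA a).
apply: (tens_eq (F := fun t => tfun epsL h t) (G :=
  fun t => h (tlift _ t))) => [c s t|c s t|u v].
- by rewrite linearP.
- by rewrite !linearP.
rewrite tfunE epsLE tliftE ?linearZ /= ?mulr_algl //; split=> [w|w] c x y /=.
  by rewrite linearP scalerDl; congr (_ + _); apply/esym/scalerA.
by rewrite linearP.
Qed.

Lemma conv1r h : conv h epsL = h.
Proof.
apply/lfunP => a; rewrite convE -[in RHS](ydh_counitr hopfA a).
apply: (tens_eq (F := fun t => tfun h epsL t) (G :=
  fun t => h (tlift _ t))) => [c s t|c s t|u v].
- by rewrite linearP.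
- by rewrite !linearP.
rewrite tfunE epsLE tliftE ?linearZ /= ?mulr_algr //; split=> [w|w] c x y /=.
  by rewrite linearP.
by rewrite linearP scalerDl; congr (_ + _); apply/esym/scalerA.
Qed.

Lemma conv_gact h h' g a : conv h h' (act g a) = conv (h \o act g)%VF (h' \o act g)%VF a.
Proof.
rewrite !convE (yd_hom_act (ydh_comul hopfA)).
apply: (tens_eq (F := fun t => tfun h h' (yd_act (yd_tens X X) (gelt K g) t))
  (G := fun t => tfun (h \o act g) (h' \o act g) t)) => [c s t|c s t|u v].
- by rewrite !linearP.
- by rewrite linearP.
by rewrite yd_act_tensE !tfunE !comp_lfunE.
Qed.

Lemma conv_hcomp h h' m a : conv h h' (pi m a) =
  \sum_g \sum_k (m == (g * k)%g)%:R * conv (h \o pi g)%VF (h' \o pi k)%VF a.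
Proof.
rewrite convE -(hcomp_hom _ _ (ydh_comul hopfA)).
have -> : \sum_g \sum_k (m == (g * k)%g)%:R * conv (h \o pi g)%VF (h' \o pi k)%VF a =
  \sum_g \sum_k (m == (g * k)%g)%:R * tfun (h \o pi g)%VF (h' \o pi k)%VF (Delta a).
  by apply: eq_bigr => g _; apply: eq_bigr => k _; rewrite convE.
apply: (tens_eq (F := fun t => tfun h h' (hcomp (yd_tens X X) m t))
  (G := fun t => \sum_g \sum_k (m == (g * k)%g)%:R * tfun (h \o pi g) (h' \o pi k) t))
  => [c s t|c s t|u v].
- by rewrite !linearP.
- rewrite scaler_sumr -big_split; apply: eq_bigr => g _.
  rewrite scaler_sumr -big_split; apply: eq_bigr => k _.
  by rewrite linearP mulrDr scalerAr.
rewrite hcomp_tens linear_sum; apply: eq_bigr => g _; rewrite linear_sum.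
by apply: eq_bigr => k _; rewrite linearZ /= !tfunE !comp_lfunE scaler_nat mulr_natl.
Qed.

(** The dual form of the braided multiplicativity of [Delta]; it becomes the twisted coproduct
    formula of the dual algebra. *)
Lemma conv_mul h h' a c : alg_hom h -> alg_hom h' ->
  conv h h' (a * c) = \sum_g conv h (h' \o pi g)%VF a * conv (h \o act g)%VF h' c.
Proof.
move=> [hM _] [h'M _]; rewrite convE (ydh_comulM hopfA).
have -> : \sum_g conv h (h' \o pi g)%VF a * conv (h \o act g)%VF h' c =
  \sum_g tfun h (h' \o pi g)%VF (Delta a) * tfun (h \o act g)%VF h' (Delta c).
  by apply: eq_bigr => g _; rewrite !convE.
move: (Delta a) (Delta c) => s t.
apply: (tens_eq (F := fun s => tfun h h' (braided_mul X s t))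
  (G := fun s => \sum_g tfun h (h' \o pi g)%VF s * tfun (h \o act g)%VF h' t)) s => [k s s'|k
    s s'|a1 a2].
- by rewrite linearP add_lfunE scale_lfunE linearP.
- rewrite scaler_sumr -big_split; apply: eq_bigr => g _.
  by rewrite linearP mulrDl scalerAl.
apply: (tens_eq (F := fun t => tfun h h' (braided_mul X (a1 \ot a2) t))
  (G := fun t => \sum_g tfun h (h' \o pi g)%VF (a1 \ot a2) * tfun (h \o act g)%VF h' t)) t =>
    [k s t|k s t|c1 c2].
- by rewrite !linearP.
- rewrite scaler_sumr -big_split; apply: eq_bigr => g _.
  by rewrite linearP mulrDr scalerAr.
rewrite braided_mulE coact_hcomp !linear_sum; apply: eq_bigr => g _ /=.
have [pl pr] := @pure_tens_bilin K A A.
rewrite tliftE ?tfunE ?hM ?h'M ?comp_lfunE //; first by rewrite mulrACA -!mulrA;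
  congr (_ * _); rewrite mulrCA.
split=> [w|w] k x y /=.
  by rewrite linearP add_lfunE scale_lfunE mulrDr -scalerAr pl.
by rewrite mulrDl -scalerAl pr.
Qed.

(** Composition with the antipode inverts [h], because [h] is multiplicative. *)
Lemma conv_antipode_l h : alg_hom h -> exists h', conv h' h = epsL.
Proof.
move=> [hM h1]; have [S [_ SL _]] := ydh_antipode hopfA; exists (h \o S)%VF.
apply/lfunP => a; rewrite convE epsLE.
have <- : h (eps a : K)%:A = (eps a : K)%:A by rewrite linearZ /= h1.
rewrite -SL.
apply: (tens_eq (F := fun t => tfun (h \o S) h t) (G :=
  fun t => h (tlift _ t))) => [c s t|c s t|u v].
- by rewrite linearP.
- by rewrite !linearP.
rewrite tfunE tliftE ?hM ?comp_lfunE //; split=> [w|w] k x y /=.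
  by rewrite linearP mulrDl -scalerAl.
by rewrite mulrDr -scalerAr.
Qed.

Lemma conv_antipode_r h : alg_hom h -> exists h', conv h h' = epsL.
Proof.
move=> [hM h1]; have [S [_ _ SR]] := ydh_antipode hopfA; exists (h \o S)%VF.
apply/lfunP => a; rewrite convE epsLE.
have <- : h (eps a : K)%:A = (eps a : K)%:A by rewrite linearZ /= h1.
rewrite -SR.
apply: (tens_eq (F := fun t => tfun h (h \o S) t) (G :=
  fun t => h (tlift _ t))) => [c s t|c s t|u v].
- by rewrite linearP.
- by rewrite !linearP.
rewrite tfunE tliftE ?hM ?comp_lfunE //; split=> [w|w] k x y /=.
  by rewrite mulrDl -scalerAl.
by rewrite linearP mulrDr -scalerAr.
Qed.

Lemma conv_1 h h' : alg_hom h -> alg_hom h' -> conv h h' 1 = 1.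
Proof. by move=> [_ h1] [_ h'1]; rewrite convE (ydh_comul1 hopfA) tfunE h1 h'1 mulr1. Qed.

Lemma epsL_alg_hom : alg_hom epsL.
Proof.
split=> [a c|]; rewrite !epsLE ?(ydh_counit1 hopfA) ?scale1r //.
by rewrite (ydh_counitM hopfA) -scalerAl -scalerAr scalerA mulr1.
Qed.

End Hopf.

(** * The dual algebra *)

Section Dual.
Variables (K : fieldType) (gT : finGroupType) (A : falgType K) (X : yd_data gT A).
Variables (Delta : 'Hom(A, tens A A)) (eps : 'Hom(A, K^o)).
Hypothesis hopfA : is_yd_hopf X Delta eps.
Variables (L : fieldExtType K) (n : nat) (e : n.-tuple A).
Hypothesis eP : basis_of fullv e.
Local Notation pi := (hcomp X).
Local Notation act := (gact X).
Let modX := ydh_module hopfA.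

(** Functionals are modelled by their values on [e], since row vectors form a space over [L] whereas
    ['Hom(A, L)] is one over [K]. *)
Definition evl_fun (f : 'rV[L]_n) (a : A) : L := \sum_k coord e k a *: f 0 k.
Fact evl_fun_linear f : linear (evl_fun f).
Proof.
move=> c x y; rewrite /evl_fun scaler_sumr -big_split; apply: eq_bigr => k _.
by rewrite linearP scalerDl scalerA.
Qed.
HB.instance Definition _ f := GRing.isLinear.Build K A L _ (evl_fun f) (evl_fun_linear f).

Definition evl f : 'Hom(A, L) := linfun (evl_fun f).
Definition rvec (h : 'Hom(A, L)) : 'rV[L]_n := \row_k h e`_k.

Lemma evlE f a : evl f a = \sum_k coord e k a *: f 0 k.
Proof. by rewrite lfunE. Qed.

Lemma evl_vec h : evl (rvec h) = h.
Proof.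
apply/lfunP => a; rewrite evlE [a in RHS](coord_basis eP) ?memvf // linear_sum.
by apply: eq_bigr => k _; rewrite mxE linearZ.
Qed.

Lemma evl_e f (j : 'I_n) : evl f e`_j = f 0 j.
Proof.
rewrite evlE (bigD1 j) //= coord_free ?(basis_free eP) // eqxx scale1r big1 ?addr0 // => k kj.
by rewrite coord_free ?(basis_free eP) // eq_sym (negPf kj) scale0r.
Qed.

Lemma evl_inj : injective evl.
Proof. by move=> f f' E; apply/rowP => j; rewrite -!evl_e E. Qed.

Lemma evl_lin c f f' a : evl (c *: f + f') a = c * evl f a + evl f' a.
Proof.
rewrite !evlE mulr_sumr -big_split; apply: eq_bigr => k _.
by rewrite !mxE scalerDr scalerAr.
Qed.

(* The opposite of the convolution product, so that the left factor is the one
   whose degrees act in [delta]. *)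
Definition dual_mul f f' := rvec (conv Delta (evl f') (evl f)).

Lemma evl_dual_mul f f' : evl (dual_mul f f') = conv Delta (evl f') (evl f).
Proof. exact: evl_vec. Qed.

Lemma evl_sum (I : finType) (c : I -> L) (F : I -> 'rV[L]_n) a :
  evl (\sum_i c i *: F i) a = \sum_i c i * evl (F i) a.
Proof.
rewrite evlE; under [RHS]eq_bigr do rewrite evlE mulr_sumr.
rewrite exchange_big; apply: eq_bigr => k _; rewrite summxE scaler_sumr.
by apply: eq_bigr => i _; rewrite mxE scalerAr.
Qed.

Lemma evl_Z c f a : evl (c *: f) a = c * evl f a.
Proof. by have := evl_lin c f 0 a; rewrite addr0 => ->;
  rewrite [evl 0 a]evlE big1 ?addr0 // => k _; rewrite mxE scaler0. Qed.

Lemma evl_D f f' a : evl (f + f') a = evl f a + evl f' a.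
Proof. by have := evl_lin 1 f f' a; rewrite scale1r mul1r. Qed.

Lemma convDl (h h1 h2 h' : 'Hom(A, L)) (c c' : L) a : (forall u, h u = c * h1 u + c' * h2 u) ->
  conv Delta h h' a = c * conv Delta h1 h' a + c' * conv Delta h2 h' a.
Proof.
move=> hE; rewrite !convE.
rewrite (@tfun_suml K L bool A A h (fun x => if x then h1 else h2) (fun x => if x then c else
  c')).
  by rewrite big_bool.
by move=> u; rewrite big_bool hE.
Qed.

Lemma convDr (h h1 h2 h' : 'Hom(A, L)) (c c' : L) a : (forall u, h u = c * h1 u + c' * h2 u) ->
  conv Delta h' h a = c * conv Delta h' h1 a + c' * conv Delta h' h2 a.
Proof.
move=> hE; rewrite !convE.
rewrite (@tfun_sumr K L bool A A h' (fun x => if x then h1 else h2) (fun x => if x then c else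
  c')).
  by rewrite big_bool.
by move=> u; rewrite big_bool hE.
Qed.

Definition dual_one := rvec (epsL eps L).

Fact dual_mulA : associative dual_mul.
Proof. by move=> f f' f''; apply: evl_inj; rewrite !evl_dual_mul (convA hopfA). Qed.
Fact dual_mul1 : left_id dual_one dual_mul.
Proof. by move=> f; apply: evl_inj; rewrite evl_dual_mul evl_vec (conv1r hopfA). Qed.
Fact dual_mulr1 : right_id dual_one dual_mul.
Proof. by move=> f; apply: evl_inj; rewrite evl_dual_mul evl_vec (conv1l hopfA). Qed.
Fact dual_mulDl : left_distributive dual_mul +%R.
Proof.
move=> f f' f''; apply: evl_inj; apply/lfunP => a.
rewrite evl_D !evl_dual_mul (@convDr _ (evl f) (evl f') _ 1 1) ?mul1r // => u.
by rewrite evl_D !mul1r.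
Qed.
Fact dual_mulDr : right_distributive dual_mul +%R.
Proof.
move=> f f' f''; apply: evl_inj; apply/lfunP => a.
rewrite evl_D !evl_dual_mul (@convDl _ (evl f') (evl f'') _ 1 1) ?mul1r // => u.
by rewrite evl_D !mul1r.
Qed.
Fact dual_mulZl c f f' : c *: dual_mul f f' = dual_mul (c *: f) f'.
Proof.
apply: evl_inj; apply/lfunP => a.
rewrite evl_Z !evl_dual_mul (@convDr (evl (c *: f)) (evl f) (evl f) _ c 0) ?mul0r ?addr0 // =>
  u.
by rewrite evl_Z mul0r addr0.
Qed.
Fact dual_mulZr c f f' : c *: dual_mul f f' = dual_mul f (c *: f').
Proof.
apply: evl_inj; apply/lfunP => a.
rewrite evl_Z !evl_dual_mul (@convDl (evl (c *: f')) (evl f') (evl f') _ c 0) ?mul0r ?addr0 //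
  => u.
by rewrite evl_Z mul0r addr0.
Qed.
Fact dual_one_neq0 : dual_one != 0.
Proof.
apply/eqP => d0; have := congr1 (fun f => evl f 1) d0.
rewrite evl_vec (proj2 (epsL_alg_hom hopfA L)) -[0](scale0r 0) evl_Z mul0r => /eqP.
by rewrite oner_eq0.
Qed.

Definition dual_falg : falgType L :=
  @falg_of L ('rV[L]_n : vectType L) dual_mul dual_one dual_mulA dual_mul1 dual_mulr1
    dual_mulDl dual_mulDr dual_one_neq0 dual_mulZl dual_mulZr.

Lemma dual_algebra : exists (B : falgType L) (ev : B -> 'Hom(A, L)) (vecB : 'Hom(A, L) -> B),
  [/\ forall h, ev (vecB h) = h, injective ev,
      forall c f f' a, ev (c *: f + f') a = c * ev f a + ev f' a,
      forall f f', ev (f * f') = conv Delta (ev f') (ev f) & ev 1 = epsL eps L].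
Proof.
exists dual_falg, evl, rvec; split.
- exact: evl_vec.
- exact: evl_inj.
- exact: evl_lin.
- exact: evl_dual_mul.
- exact: (evl_vec (epsL eps L)).
Qed.

(** * Characters as a basis of grouplikes *)

Hypothesis charL0 : [pchar L] =i pred0.
Hypothesis abG : abelian [set: gT].
Variable (chi : 'I_n -> 'Hom(A, L)).
Hypothesis chi_hom : forall i, alg_hom (chi i).
Hypothesis chi_unit : \matrix_(i, j) chi i e`_j \in unitmx.
Variables (hT : finGroupType) (beta : gT -> hT -> L).
Hypothesis betaMl : forall g g' h, beta (g * g')%g h = beta g h * beta g' h.
Hypothesis betaMr : forall g h h', beta g (h * h')%g = beta g h * beta g h'.
Hypothesis beta1l : forall h, beta 1%g h = 1.
Hypothesis beta1r : forall g, beta g 1%g = 1.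
Hypothesis orth_l : forall g, \sum_h beta g h = (g == 1%g)%:R * #|hT|%:R.
Hypothesis orth_r : forall h, \sum_g beta g h = (h == 1%g)%:R * #|hT|%:R.

Local Notation M := (\matrix_(i, j) chi i e`_j).

Lemma chi_indep (c : 'I_n -> L) : (forall a, \sum_i c i * chi i a = 0) -> forall i, c i = 0.
Proof.
move=> c0 i; have E : (\row_i c i) *m M = 0 :> 'rV[L]_n.
  by apply/matrixP => o j; rewrite !mxE -[RHS](c0 e`_j); apply: eq_bigr => k _; rewrite !mxE.
have := congr1 (mulmx^~ (invmx M)) E; rewrite mulmxK // mul0mx => /matrixP/(_ 0 i).
by rewrite !mxE.
Qed.

Lemma chi_inj : injective chi.
Proof.
move=> i j E; apply/eqP; apply: contraT => ij.
have /chi_indep/(_ i)/eqP : forall a, \sum_k ((k == i)%:R - (k == j)%:R) * chi k a = 0.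
  move=> a; under eq_bigr do rewrite mulrBl; rewrite big_split /= sumrN.
  rewrite (bigD1 i) //= eqxx mul1r big1 ?addr0 => [|k /negPf->]; last by rewrite mul0r.
  rewrite (bigD1 j) //= eqxx mul1r big1 ?addr0 => [|k /negPf->]; last by rewrite mul0r.
  by rewrite E subrr.
by rewrite eqxx (negPf ij) subr0 oner_eq0.
Qed.

Variables (B : falgType L) (ev : B -> 'Hom(A, L)) (vecB : 'Hom(A, L) -> B).
Hypothesis vecBK : forall h, ev (vecB h) = h.
Hypothesis ev_inj : injective ev.
Hypothesis ev_lin : forall c f f' a, ev (c *: f + f') a = c * ev f a + ev f' a.
Hypothesis evM : forall f f', ev (f * f') = conv Delta (ev f') (ev f).
Hypothesis ev1 : ev 1 = epsL eps L.

Lemma ev_ext f f' : (forall a, ev f a = ev f' a) -> f = f'.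
Proof. by move=> E; apply/ev_inj/lfunP. Qed.

Lemma ev0 a : ev 0 a = 0.
Proof. by have := ev_lin (-1) 0 0 a; rewrite scaler0 addr0 mulN1r addNr. Qed.

Lemma ev_sum (I : finType) (c : I -> L) (F : I -> B) a :
  ev (\sum_i c i *: F i) a = \sum_i c i * ev (F i) a.
Proof.
elim/big_rec2: _ => [|i x y _ <-]; first exact: ev0.
exact: ev_lin.
Qed.

Lemma ev_Z c f a : ev (c *: f) a = c * ev f a.
Proof. by rewrite -[c *: f]addr0 ev_lin ev0 addr0. Qed.

Definition dcoord (i : 'I_n) (f : B) : L := (rvec (ev f) *m invmx M) 0 i.
Definition dbasis (i : 'I_n) : B := vecB (chi i).

Lemma vec_chi i : rvec (chi i) = row i M.
Proof. by apply/rowP => j; rewrite !mxE. Qed.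

Lemma ev_dbasis i : ev (dbasis i) = chi i.
Proof. exact: vecBK. Qed.

Lemma dcoord_lin i : scalar (dcoord i).
Proof.
move=> c f f'; rewrite /dcoord.
have -> : rvec (ev (c *: f + f')) = c *: rvec (ev f) + rvec (ev f').
  by apply/rowP => j; rewrite !mxE ev_lin.
by rewrite mulmxDl -scalemxAl !mxE.
Qed.

Lemma dcoord_b i j : dcoord i (dbasis j) = (i == j)%:R.
Proof. by rewrite /dcoord ev_dbasis vec_chi -row_mul mulmxV // !mxE eq_sym. Qed.

Lemma ev_coord f a : ev f a = \sum_i dcoord i f * chi i a.
Proof.
rewrite -[ev f in LHS]evl_vec -{1}[rvec (ev f)](mulmxKV chi_unit) mulmx_sum_row evl_sum.
by apply: eq_bigr => i _; rewrite -vec_chi evl_vec.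
Qed.

Lemma dcoord_sum f : f = \sum_i dcoord i f *: dbasis i.
Proof.
by apply: ev_ext => a; rewrite ev_sum ev_coord; apply: eq_bigr => i _; rewrite ev_dbasis.
Qed.

(** Expand [h] as a sum of c_i chi_i. Multiplicativity makes the sum of c_i (chi_i(a) - h(a)) chi_i
    vanish, so chi_i = h wherever c_i is nonzero. *)
Lemma alg_hom_chi (h : 'Hom(A, L)) : alg_hom h -> exists j, chi j = h.
Proof.
move=> [hM h1]; pose f := vecB h.
have hE a : h a = \sum_i dcoord i f * chi i a by rewrite -ev_coord vecBK.
have [j nz] : exists j, dcoord j f != 0.
  apply/existsP; apply: contraT => /existsPn c0.
  have := h1; rewrite hE big1 => [/eqP|j _]; first by rewrite eq_sym oner_eq0.
  by have := c0 j; rewrite negbK => /eqP->; rewrite mul0r.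
exists j; apply/lfunP => a.
have /chi_indep/(_ j)/eqP : forall c, \sum_i (dcoord i f * (chi i a - h a)) * chi i c = 0.
  move=> c; under eq_bigr do rewrite mulrBr mulrBl -mulrA -(proj1 (chi_hom _)) mulrAC.
  by rewrite big_split /= sumrN -hE -mulr_suml -hE hM [h c * _]mulrC subrr.
by rewrite mulf_eq0 (negPf nz) subr_eq0 => /eqP.
Qed.

Lemma alg_hom_gact (h : 'Hom(A, L)) g : alg_hom h -> alg_hom (h \o act g)%VF.
Proof.
move=> [hM h1]; split=> [a c|]; rewrite !comp_lfunE.
  by rewrite (gact_mul hopfA) hM.
by rewrite (gact_1 hopfA).
Qed.

(** The action of the dual group on functionals, passing through row vectors because the weights lie
    in [L]. *)
Definition twist (u : hT) (h : 'Hom(A, L)) : 'Hom(A, L) :=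
  evl (\sum_g beta g u *: rvec (h \o pi g)%VF).

Lemma twistE u h a : twist u h a = \sum_g beta g u * h (pi g a).
Proof.
by rewrite /twist evl_sum; apply: eq_bigr => g _; rewrite evl_vec comp_lfunE.
Qed.

Lemma alg_hom_twist (h : 'Hom(A, L)) u : alg_hom h -> alg_hom (twist u h).
Proof.
move=> [hM h1]; split=> [a c|]; rewrite !twistE.
  transitivity (\sum_g \sum_k beta (g * k)%g u * (h (pi g a) * h (pi k c))).
    under eq_bigr => m _.
      rewrite (hcomp_mul hopfA) linear_sum mulr_sumr.
      under eq_bigr => g _.
        rewrite linear_sum mulr_sumr.
        under eq_bigr => k _ do rewrite linearZ /= hM scaler_nat mulrnAr.
        over.
      over.
    rewrite exchange_big /=; apply: eq_bigr => g _.
    rewrite exchange_big /=; apply: eq_bigr => k _.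
    rewrite (bigD1 (g * k)%g) //= eqxx mulr1n big1 ?addr0 // => m /negPf->.
    by rewrite mulr0n.
  rewrite mulr_suml; apply: eq_bigr => g _; rewrite mulr_sumr; apply: eq_bigr => k _.
  by rewrite betaMl mulrACA.
rewrite (bigD1 1%g) //= (hcomp_1 hopfA) eqxx h1 beta1l mulr1 big1 ?addr0 // => g /negPf g1.
by rewrite (hcomp_1 hopfA) g1 linear0 mulr0.
Qed.

Lemma twist_twist u v (h : 'Hom(A, L)) : twist u (twist v h) = twist (u * v)%g h.
Proof.
apply/lfunP => a; rewrite !twistE; apply: eq_bigr => g _.
rewrite twistE (bigD1 g) //= (hcomp_hcomp modX) eqxx scale1r big1 ?addr0 => [|k kg].
  by rewrite betaMr mulrA.
by rewrite (hcomp_hcomp modX) (negPf kg) scale0r linear0 mulr0.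
Qed.

Lemma twist1 (h : 'Hom(A, L)) : twist 1%g h = h.
Proof.
apply/lfunP => a; rewrite twistE -[in RHS](hcomp_sum modX a) linear_sum.
by apply: eq_bigr => g _; rewrite beta1r mul1r.
Qed.

(** Action and twist preserve algebra homomorphisms, hence permute the [chi i]; the rest verifies
    the hypotheses of [all_compatible] for these permutations. *)
Lemma chi_compatible (coX : coprime n #|gT|) i j g :
  (exists a, chi i (pi g a) != 0) -> forall a, chi j (act g a) = chi j a.
Proof.
have chi_perm (F : 'Hom(A, L) -> 'Hom(A, L)) :
  injective F -> (forall h, alg_hom h -> alg_hom (F h)) ->
    exists s : {perm 'I_n}, forall i, chi (s i) = F (chi i).
  move=> Finj Fhom.
  have [r rE] : exists r : 'I_n -> 'I_n, forall i, chi (r i) = F (chi i).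
    have H k : exists j, chi j = F (chi k) by apply/alg_hom_chi/Fhom.
    exact: (fin_all_exists H).
  have rinj : injective r by move=> k l E; apply/chi_inj/Finj; rewrite -!rE E.
  by exists (perm rinj) => k; rewrite permE.
have [rho rhoE] : exists rho : gT ->
  {perm 'I_n}, forall g i, chi (rho g i) = (chi i \o act g)%VF.
  suff H k : exists s : {perm 'I_n}, forall i, chi (s i) = (chi i \o act k)%VF.
    exact: (fin_all_exists H).
  apply: (chi_perm (fun h => (h \o act k)%VF)) => [h h' E|h]; last exact: alg_hom_gact.
  apply/lfunP => a; have /lfunP/(_ (act k^-1%g a)) := E.
  by rewrite !comp_lfunE -(gactM modX) mulgV (gact1 modX).
have [tau tauE] : exists tau : hT -> {perm 'I_n}, forall u i, chi (tau u i) = twist u (chi i).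
  suff H u : exists s : {perm 'I_n}, forall i, chi (s i) = twist u (chi i).
    exact: (fin_all_exists H).
  apply: (chi_perm (twist u)) => [h h' E|h]; last exact: alg_hom_twist.
  by rewrite -[h]twist1 -[h']twist1 -(mulVg u) -!twist_twist E.
have [e0 e0E] := alg_hom_chi (epsL_alg_hom hopfA L).
have bM x y : ev (dbasis x * dbasis y) = conv Delta (chi y) (chi x).
  by rewrite evM !ev_dbasis.
have pextE s f a : ev (pext dbasis dcoord s f) a = \sum_k dcoord k f * chi (s k) a.
  by rewrite (lextE dcoord_lin) ev_sum; apply: eq_bigr => k _; rewrite ev_dbasis.
have pext_rho k f a : ev (pext dbasis dcoord (rho k) f) a = ev f (act k a).
  by rewrite pextE ev_coord; apply: eq_bigr => l _; rewrite rhoE comp_lfunE.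
have pext_tau u f a : ev (pext dbasis dcoord (tau u) f) a = \sum_m beta m u * ev f (pi m a).
  rewrite pextE; under [RHS]eq_bigr do rewrite ev_coord mulr_sumr.
  rewrite exchange_big; apply: eq_bigr => l _; rewrite tauE twistE mulr_sumr.
  by apply: eq_bigr => m _; rewrite mulrCA.
have comm_rr k l : (rho k * rho l = rho l * rho k)%g.
  apply/permP => x; apply: chi_inj; rewrite !permM !rhoE; apply/lfunP => a.
  rewrite !comp_lfunE -!(gactM modX); congr (chi x (act _ a)).
  by apply: (centsP abG); rewrite inE.
have comm_tt u v : (tau u * tau v = tau v * tau u)%g.
  apply/permP => x; apply: chi_inj; rewrite !permM !tauE; apply/lfunP => a.
  by rewrite !twist_twist !twistE; apply: eq_bigr => m _; rewrite !betaMr [_ * beta m u]mulrC.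
have comm_rt k u : (rho k * tau u = tau u * rho k)%g.
  apply/permP => x; apply: chi_inj; rewrite !permM rhoE !tauE rhoE; apply/lfunP => a.
  rewrite !twistE comp_lfunE twistE; apply: eq_bigr => m _.
  by rewrite comp_lfunE (hcomp_gact modX).

have cardhT0 : (#|hT|%:R : L) != 0.
  by move/pcharf0P: charL0 => ->; rewrite -lt0n; apply/card_gt0P; exists 1%g.
have betaV k u : (beta k u)^-1 = beta k^-1%g u.
  have E : beta k u * beta k^-1%g u = 1 by rewrite -betaMl mulgV beta1l.
  have b0 : beta k u != 0 by apply/eqP => b0; move/eqP: E; rewrite b0 mul0r eq_sym oner_eq0.
  by apply: (mulfI b0); rewrite E divff.
have compE k f a : ev (wcomp dbasis dcoord tau beta k f) a = ev f (pi k a).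
  rewrite wcompE ev_Z ev_sum.
  under eq_bigr => u _ do rewrite pext_tau mulr_sumr.
  rewrite exchange_big (bigD1 k) //= [X in _ + X]big1 ?addr0 => [|m mk].
    under eq_bigr => u _ do rewrite mulrA betaV -betaMl mulVg beta1l mul1r.
    by rewrite sumr_const -[X in _ * X]mulr_natl mulKf.
  under eq_bigr => u _ do rewrite mulrA betaV -betaMl.
  by rewrite -mulr_suml orth_l -eq_mulVg1 eq_sym (negPf mk) !mul0r.
have autP (s : {perm 'I_n}) : (forall k, s * rho k = rho k * s)%g ->
  (forall u, s * tau u = tau u * s)%g ->
    (forall x y a, ev (pext dbasis dcoord s (dbasis x * dbasis y)) a
      = conv Delta (chi (s y)) (chi (s x)) a) -> s \in ydaut dbasis dcoord rho tau.
  move=> sr st sM; rewrite inE; apply/and3P; split.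
  - by apply/forallP => k; apply/eqP.
  - by apply/forallP => u; apply/eqP.
  apply/forallP => x; apply/forallP => y; apply/eqP/ev_ext => a.
  by rewrite sM bM.
have delta x y z w : (z == w)%:R * dcoord z (dbasis x * dbasis y) =
  \sum_k dcoord z (dbasis x * dbasis (rho k y))
     * dcoord w (wcomp dbasis dcoord tau beta k (dbasis x) * dbasis y).
  set Q := \sum_k _.
  pose R z w := \sum_k dcoord z (dbasis x * dbasis (rho k y))
     * dcoord w (wcomp dbasis dcoord tau beta k (dbasis x) * dbasis y).
  (* Coefficients in the tensor square are compared by evaluating at [c] and [a]; independence of
     the characters is used once in each variable. *)
  suff E : forall a c, \sum_w0 \sum_z0 ((z0 == w0)%:R * dcoord z0 (dbasis x * dbasis y) - R z0
    w0)
      * chi z0 c * chi w0 a = 0.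
    apply/eqP; rewrite -subr_eq0; apply/eqP; rewrite -/(R z w).
    apply: (chi_indep (c := fun z0 => (z0 == w)%:R * dcoord z0 (dbasis x * dbasis y) - R z0
      w)) => c.
    apply: (chi_indep (c := fun w0 => \sum_z0 ((z0 == w0)%:R * dcoord z0 (dbasis x * dbasis y)
      - R z0 w0) * chi z0 c)) => a.
    by rewrite -[RHS](E a c); apply: eq_bigr => w0 _; rewrite mulr_suml.
  move=> a c; under eq_bigr => w0 _.
    under eq_bigr => z0 _ do rewrite !mulrBl.
    rewrite big_split /= sumrN; over.
  rewrite big_split /= sumrN; apply/eqP; rewrite subr_eq0; apply/eqP.
  (* The value at [a * c] is computed twice: by multiplicativity of the characters, and by
     [conv_mul]. *)
  transitivity (ev (dbasis x * dbasis y) (a * c)).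
    rewrite ev_coord; apply: eq_bigr => w0 _; rewrite (bigD1 w0) //= eqxx mul1r.
    rewrite big1 ?addr0 => [|z0 /negPf->]; last by rewrite !mul0r.
    by rewrite (proj1 (chi_hom w0)) -mulrA [chi w0 c * _]mulrC.
  rewrite bM (conv_mul hopfA) //.
  transitivity (\sum_k ev (wcomp dbasis dcoord tau beta k (dbasis x) * dbasis y) a
      * ev (dbasis x * dbasis (rho k y)) c).
    apply: eq_bigr => k _; rewrite bM rhoE evM ev_dbasis; congr (conv _ _ _ a * _).
    by apply/lfunP => d; rewrite comp_lfunE compE ev_dbasis.
  under eq_bigr => k _ do rewrite ev_coord mulr_suml.
  rewrite exchange_big; apply: eq_bigr => w0 _; rewrite /R.
  under [RHS]eq_bigr => z0 _ do rewrite -mulrA mulr_suml.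
  rewrite exchange_big; apply: eq_bigr => k _; rewrite [ev _ c]ev_coord mulr_sumr.
  apply: eq_bigr => z0 _.
  by rewrite mulrACA [dcoord w0 _ * _]mulrC [chi w0 a * _]mulrC.
have compat : forall x y, compatible dbasis dcoord rho tau beta x y.
  apply: (@all_compatible L B _ dbasis dcoord dcoord_lin charL0 dcoord_b dcoord_sum
    e0 gT hT rho tau beta) => //.
  - by apply: ev_inj; rewrite ev_dbasis e0E ev1.
  (* As the product is opposite to convolution, [h'] gives a right inverse and [h''] a left one;
     they coincide. *)
  - move=> x; have [h' h'E] := conv_antipode_l hopfA (chi_hom x).
    have [h'' h''E] := conv_antipode_r hopfA (chi_hom x).
    have E1 : dbasis x * vecB h' = 1 by apply: ev_inj; rewrite evM ev_dbasis vecBK h'E ev1.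
    have E2 : vecB h'' * dbasis x = 1 by apply: ev_inj; rewrite evM ev_dbasis vecBK h''E ev1.
    apply/unitrP; exists (vecB h'); split=> //.
    by rewrite -[X in X * _]mul1r -E2 -(mulrA (vecB h'')) E1 mulr1.
  - move=> k l; apply/permP => x; apply: chi_inj; rewrite permM !rhoE; apply/lfunP => a.
    by rewrite !comp_lfunE (gactM modX).
  - move=> u v; apply/permP => x; apply: chi_inj; rewrite permM !tauE twist_twist;
    apply/lfunP => a.
    by rewrite !twistE; apply: eq_bigr => m _; rewrite !betaMr [_ * beta m u]mulrC.
  - move=> k; apply: autP => // x y a.
    rewrite pext_rho bM (conv_gact hopfA) !rhoE //.
  - move=> u; apply: autP => // x y a.
    rewrite pext_tau bM.
    under eq_bigr => m _ do rewrite (conv_hcomp hopfA) mulr_sumr.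
    rewrite exchange_big /= convE (@tfun_suml _ _ _ _ _ _ (fun k => chi y \o pi k)%VF (fun k
      => beta k u)); last first.
      by move=> d; rewrite tauE twistE; apply: eq_bigr => m _; rewrite comp_lfunE.
    apply: eq_bigr => k _.
    rewrite (@tfun_sumr _ _ _ _ _ _ (fun k => chi x \o pi k)%VF (fun k => beta k u));
      last first.
      by move=> d; rewrite tauE twistE; apply: eq_bigr => m _; rewrite comp_lfunE.
    under eq_bigr => m _ do rewrite mulr_sumr.
    rewrite exchange_big mulr_sumr; apply: eq_bigr => l _ /=.
    rewrite (bigD1 (k * l)%g) //= eqxx mul1r big1 ?addr0 => [|m /negPf->];
      last by rewrite mul0r mulr0.
    by rewrite betaMl convE mulrA.
  - move=> x y; transitivity (ev (dbasis x * dbasis y) 1).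
      by rewrite ev_coord; apply: eq_bigr => z _; rewrite (proj2 (chi_hom z)) mulr1.
    by rewrite bM (conv_1 hopfA).
  - by rewrite card_ord.
move=> [a0 nz] a; have := compat i j g; rewrite inE => H.
rewrite -[LHS]comp_lfunE -rhoE H //; apply: contraNneq nz => c0.
by rewrite -ev_dbasis -compE c0 ev0.
Qed.

End Dual.

(** * Triviality of the quasisymmetry *)

Theorem theorem1 (K : fieldType) (charK0 : [pchar K] =i pred0)
    (gT : finGroupType) (abelG : abelian [set: gT])
    (A : falgType K) (X : yd_data gT A)
    (Delta : 'Hom(A, tens A A)) (eps : 'Hom(A, K^o))
    (hopfA : is_yd_hopf X Delta eps)
    (commA : forall a b : A, a * b = b * a)
    (ssA : semisimple_alg A)
    (coprime_dim : coprime (\dim {:A}) #|gT|) :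
  forall a a' : A, quasisym X X (a \ot a') = a' \ot a.
Proof.
have redA := semisimple_reduced commA ssA.
have [n [e [eP dimA]]] : exists n (e : n.+1.-tuple A), basis_of fullv e /\ n.+1 = \dim {:A}.
  have : (0 < \dim {:A})%N by rewrite dimvf; apply: FalgType_proper.
  move: (vbasis {:A}) (vbasisP {:A}) coprime_dim; case: (\dim {:A}) => // n e eP _ _.
  by exists n, e.
have [q qP] : exists q : 'I_n.+1 -> {poly K}, forall j : 'I_n.+1,
    separable_poly (q j) /\ horner_alg (e`_j : A) (q j) = 0.
  have H (j : 'I_n.+1) : exists q : {poly K}, separable_poly q /\ horner_alg (e`_j : A) q = 0.
    by have [q sq qe] := separable_annihilator commA eP charK0 redA e`_j; exists q.
  exact: (fin_all_exists H).
have G_gt0 : (0 < #|gT|)%N by apply/card_gt0P; exists 1%g.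
(* Its splitting field contains the eigenvalues of multiplication by the basis elements and the
   roots of unity needed for the dual group. *)
pose p := ('X^#|gT| - 1) * \prod_j q j.
have p0 : p != 0.
  apply: mulf_neq0; first by rewrite monic_neq0 // monicXnsubC.
  by apply/prodf_neq0 => j _; apply: separable_poly_neq0; have [] := qP j.
have [L [zs pL]] := splitting_field_exists p0.
have charL0 : [pchar L] =i pred0 by move=> x; rewrite pchar_lalg charK0.
have [chi [chi_hom chi_unit]] : exists chi : 'I_n.+1 -> 'Hom(A, L),
    (forall i, alg_hom (chi i)) /\ (\matrix_(i, j) chi i e`_j \in unitmx).
  apply: (alg_homs_exist commA eP (zs := zs)) => j; exists (q j).
  have [sq qe] := qP j; split=> //; rewrite -(eqp_dvdr _ pL) dvdp_map.
  by rewrite /p (bigD1 j) //= mulrCA dvdp_mulr.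
have [zeta prim] : exists z : L, #|gT|.-primitive_root z.
  apply: (prim_root_exists (zs := zs)) => //; rewrite -(eqp_dvdr _ pL).
  have -> : 'X^#|gT| - 1 = map_poly (in_alg L) ('X^#|gT| - 1) :> {poly L}.
    by rewrite rmorphB rmorphXn /= map_polyX rmorph1.
  by rewrite dvdp_map dvdp_mulr.
have [hT [beta [bMl bMr b1l b1r [orth_l orth_r]]]] := dual_group_exists abelG prim.
have [B [ev [vecB [vecBK ev_inj ev_lin evM ev1]]]] := dual_algebra hopfA L eP.
have coG : coprime n.+1 #|gT| by rewrite dimA.
have compat := chi_compatible hopfA eP charL0 abelG chi_hom chi_unit bMl bMr b1l b1r orth_l orth_r
  vecBK ev_inj ev_lin evM ev1 coG.
(* The characters separate points, their matrix on the basis being invertible. *)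
have sep c : (forall i, chi i c = 0) -> c = 0.
  move=> c0; pose v : 'cV[L]_n.+1 := \col_j (coord e j c)%:A.
  have Mv : (\matrix_(i, j) chi i e`_j) *m v = 0.
    apply/matrixP => i o; rewrite !mxE -[RHS](c0 i) [c in RHS](coord_basis eP) ?memvf //
      linear_sum.
    by apply: eq_bigr => j _; rewrite !mxE linearZ /= mulr_algr.
  have v0 : v = 0 by rewrite -(mulKmx chi_unit v) Mv mulmx0.
  rewrite (coord_basis eP (memvf c)) big1 // => j _.
  have /matrixP/(_ j 0)/eqP := v0; rewrite !mxE scaler_eq0 oner_eq0 orbF => /eqP->.
  by rewrite scale0r.
move=> a a'; rewrite quasisym_hcomp.
rewrite -[in RHS](hcomp_sum (ydh_module hopfA) a) pure_tens_sumr; apply: eq_bigr => g _.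
(* If the component of degree [g] is nonzero, some character detects it; by [compat], no character
   then distinguishes [a'] from its image under [g]. *)
have [-> |nz] := eqVneq (hcomp X g a) 0.
  by rewrite -[0](scale0r 0) !pure_tensZr !scale0r.
congr (_ \ot _); apply/eqP; rewrite -subr_eq0; apply/eqP/sep => j.
have [i ni] : exists i, chi i (hcomp X g a) != 0.
  apply/existsP; apply: contraNT nz => /existsPn h; apply/eqP/sep => i.
  by apply/eqP; move/negPn: (h i).
by rewrite linearB /= (compat i j g) ?subrr //; exists a.
Qed.
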